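(* APSD enumeration on graphs with edge weights in $\{0,\dots,n^c\}$, for some constant $c$, can be solved (without preprocessing) with delay in $O(\overline{\Delta}+\log n)$ and with space complexity in $\Theta(n)$.
   Context: Input: a directed or undirected graph $G=(V,E)$, $V=\{1,\dots,n\}$, with weights $w:E\to\{0,\dots,n^c\}$ ($c$ a constant). $\overline{\Delta}$ is the average (out-)degree. $d(u,v)$ is the minimum total weight of a $u$-$v$ path, $\infty$ if none, $d(u,u)=0$. APSD enumeration: output, for each ordered pair $u,v\in V$, the triple $(u,v,d(u,v))$ exactly once. Delay in $O(f)$: time to first output, between consecutive outputs, and to signal termination after the last output are each $O(f)$. Model: word RAM with word size $\Omega(\log n)$, read-only adjacency lists with constant-time access to $n$ and vertex degrees. *)

(* Defs.v *)
(* World: Mathematical Components. *)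
From mathcomp Require Import all_boot all_order all_algebra.

Set Implicit Arguments.
Unset Strict Implicit.
Unset Printing Implicit Defensive.

(** * Weighted graphs, distances *)

(* An undirected graph is represented by its symmetric adjacency relation, so
   that [outdeg] is the degree and [avg_deg] is 2|E|/n on loopless undirected
   graphs.  Loops are allowed.  [wt u v] is meaningful only when [edge u v]. *)
Record wgraph (n : nat) := WGraph {
  directed : bool;
  edge : rel 'I_n;
  wt : 'I_n -> 'I_n -> nat;
  undirectedP : ~~ directed ->
    forall u v, edge u v -> edge v u /\ wt v u = wt u v
}.

Definition outdeg n (G : wgraph n) (u : 'I_n) : nat := #|[pred v | edge G u v]|.

Definition avg_deg n (G : wgraph n) : rat :=
  ((\sum_u outdeg G u)%N%:R / n%:R)%R.

Definition weights_le n (G : wgraph n) (b : nat) : Prop :=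
  forall u v, edge G u v -> wt G u v <= b.

Fixpoint path_weight n (G : wgraph n) (u : 'I_n) (p : seq 'I_n) : nat :=
  if p is v :: p' then wt G u v + path_weight G v p' else 0.

Definition uv_path n (G : wgraph n) (u v : 'I_n) (p : seq 'I_n) : Prop :=
  path (edge G) u p /\ last u p = v.

(* [None] stands for the distance infinity.  The empty path makes d(u,u) = 0. *)
Definition is_dist n (G : wgraph n) (u v : 'I_n) (d : option nat) : Prop :=
  match d with
  | Some x => (exists2 p, uv_path G u v p & path_weight G u p = x) /\
              (forall p, uv_path G u v p -> x <= path_weight G u p)
  | None => forall p, ~ uv_path G u v p
  end.

(** * Word RAM *)

Inductive binop :=
| OpAdd | OpSub | OpMul | OpDiv | OpMod
| OpAnd | OpOr | OpXor | OpShl | OpShr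
| OpLt | OpEq.

(* Registers, constants and jump targets are fixed by the program; memory and
   input addresses are register contents. *)
Inductive instr :=
| Const (r k : nat)                (* r := k *)
| Move (r a : nat)                 (* r := a *)
| Bin (o : binop) (r a b : nat)    (* r := a o b *)
| Read (r a : nat)                 (* r := mem[a] *)
| Write (a r : nat)                (* mem[a] := r *)
| Input (r a : nat)                (* r := input[a] *)
| Jump (l : nat)
| JumpZ (r l : nat)                (* jump to l if r = 0 *)
| Emit (u v d : nat)               (* output (u, v, d) *)
| EmitInf (u v : nat)              (* output (u, v, infinity) *)
| Halt.

Definition program := seq instr.

(* Arithmetic on W-bit words, modulo 2^W. *)
Definition eval_binop (W : nat) (o : binop) (x y : nat) : nat :=
  (match o with
   | OpAdd => x + y
   | OpSub => x + 2 ^ W - y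
   | OpMul => x * y
   | OpDiv => x %/ y
   | OpMod => x %% y
   | OpAnd => Nat.land x y
   | OpOr => Nat.lor x y
   | OpXor => Nat.lxor x y
   | OpShl => x * 2 ^ y
   | OpShr => x %/ 2 ^ y
   | OpLt => x < y
   | OpEq => x == y
   end) %% 2 ^ W.

Definition triple : Type := (nat * nat * option nat)%type.

(* [used] is 1 + the highest memory address accessed so far (0 if none), so
   untouched cells below a used one are charged too.  The read-only input is
   not charged; neither are the registers, whose number is fixed by the
   program. [outs] lists the outputs in order, each with its time. *)
Record config := Config {
  pc : nat;
  reg : nat -> nat;
  ram : nat -> nat;
  clock : nat;
  used : nat;
  outs : seq (nat * triple)
}.

Definition upd (f : nat -> nat) (a x : nat) : nat -> nat :=
  fun b => if b == a then x else f b.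

(* One instruction takes one time unit.  [None] when halted, which also happens
   when the program counter leaves the program. *)
Definition step (W : nat) (P : program) (input : nat -> nat) (s : config)
  : option config :=
  let: Config pc r m t sp os := s in
  match nth Halt P pc with
  | Const d k => Some (Config pc.+1 (upd r d (k %% 2 ^ W)) m t.+1 sp os)
  | Move d a => Some (Config pc.+1 (upd r d (r a)) m t.+1 sp os)
  | Bin o d a b =>
      Some (Config pc.+1 (upd r d (eval_binop W o (r a) (r b))) m t.+1 sp os)
  | Read d a =>
      Some (Config pc.+1 (upd r d (m (r a))) m t.+1 (maxn sp (r a).+1) os)
  | Write a b =>
      Some (Config pc.+1 r (upd m (r a) (r b)) t.+1 (maxn sp (r a).+1) os)
  | Input d a => Some (Config pc.+1 (upd r d (input (r a))) m t.+1 sp os)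
  | Jump l => Some (Config l r m t.+1 sp os)
  | JumpZ a l => Some (Config (if r a == 0 then l else pc.+1) r m t.+1 sp os)
  | Emit u v d =>
      Some (Config pc.+1 r m t.+1 sp
              (rcons os (t.+1, (r u, r v, Some (r d)))))
  | EmitInf u v =>
      Some (Config pc.+1 r m t.+1 sp (rcons os (t.+1, (r u, r v, None))))
  | Halt => None
  end.

Definition init (mem0 : nat -> nat) : config :=
  Config 0 (fun=> 0) mem0 0 0 [::].

Definition halts_with (W : nat) (P : program) (input mem0 : nat -> nat)
    (s : config) : Prop :=
  (exists t, iter t (obind (step W P input)) (Some (init mem0)) = Some s) /\
  step W P input s = None.

(** * Input representation *)

(* A null-terminated linked list of (neighbour, weight, next) cells at [p]. *)
Fixpoint list_at (W : nat) (input : nat -> nat) (p : nat)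
    (l : seq (nat * nat)) : Prop :=
  match l with
  | [::] => p = 0
  | (v, w) :: l' =>
      [/\ p <> 0, p.+2 < 2 ^ W, input p = v, input p.+1 = w
        & list_at W input (input p.+2) l']
  end.

(* Vertices are numbered 0, ..., n-1.  Address 0 holds n, addresses 2u+1 and
   2u+2 hold the degree of u and a pointer to its list, which may come in any
   order and be stored anywhere.  Other addresses hold arbitrary words. *)
Definition adj_lists (W n : nat) (G : wgraph n) (input : nat -> nat) : Prop :=
  [/\ forall a, input a < 2 ^ W,
      input 0 = n
    & forall u : 'I_n,
        input (u.*2.+1) = outdeg G u /\
        exists2 l, list_at W input (input u.*2.+2) l
          & perm_eq l [seq (val v, wt G u v) | v <- enum 'I_n & edge G u v]].

(* Weights are at most n^c, the word size is at least k times the number of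
   binary digits of n (hence Omega(log n)), and the initial contents of the
   working memory are arbitrary words. *)
Definition instance (c k W n : nat) (G : wgraph n) (input mem0 : nat -> nat)
  : Prop :=
  [/\ weights_le G (n ^ c), k * (trunc_log 2 n).+1 <= W,
      adj_lists W G input & forall a, mem0 a < 2 ^ W].

(** * APSD enumeration, delay, space *)

Definition enumerates_APSD n (G : wgraph n) (os : seq triple) : Prop :=
  perm_eq [seq o.1 | o <- os]
          [seq (val u, val v) | u <- enum 'I_n, v <- enum 'I_n] /\
  forall (u v : 'I_n) d, (val u, val v, d) \in os -> is_dist G u v d.

Definition solves_APSD (c k : nat) (P : program) : Prop :=
  forall W n (G : wgraph n) input mem0, instance c k W G input mem0 ->
  exists2 s, halts_with W P input mem0 s
    & enumerates_APSD G [seq o.2 | o <- outs s].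

(* Time to the first output, between consecutive outputs, and from the last
   output to termination, for a run with final configuration [s]. *)
Definition delay_le (s : config) (D : rat) : Prop :=
  path (fun t t' : nat => (t'%:R - t%:R <= D :> rat)%R) 0
       (rcons [seq o.1 | o <- outs s] (clock s)).

(* Asymptotic bounds are uniform over n >= 2, so that log n > 0. *)
Definition delay_in_O (c k : nat) (P : program)
    (f : forall n, wgraph n -> rat) : Prop :=
  exists C : nat, forall W n (G : wgraph n) input mem0 s,
    1 < n -> instance c k W G input mem0 -> halts_with W P input mem0 s ->
    delay_le s (C%:R * f n G)%R.

(* For each word size, the worst-case space over the instances with n vertices
   lies between g n / a and b * g n. *)
Definition space_in_Theta (c k : nat) (P : program) (g : nat -> nat) : Prop :=
  exists a b : nat, forall W n, 1 < n -> k * (trunc_log 2 n).+1 <= W ->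
    (forall (G : wgraph n) input mem0 s,
       instance c k W G input mem0 -> halts_with W P input mem0 s ->
       used s <= b * g n) /\
    (exists (G : wgraph n) input mem0 s,
       [/\ instance c k W G input mem0, halts_with W P input mem0 s
         & g n <= a * used s]).

(* Main.v *)
Require Import Defs.
From mathcomp Require Import all_boot all_order all_algebra.
From mathcomp Require Import zify.

(** Run Dijkstra's algorithm from every vertex, and output the n - 1 nontrivial
    distances from vertex s at a steady pace while the distances from s + 1
    are being computed; the n trivial outputs (v, v, 0) cover the summation of
    the degrees, which determines the pace, and the first run.  A run takes
    O(m + n log n) steps and at least n/2 outputs are pending, so a pace of
    O(m/n + log n) steps per output suffices.  Pacing is a program
    transformation that inserts a tick after every step of the Dijkstra code.

    As the distances have O(log n) bits, the priority queue is a radix heap: the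
    bucket of a key is determined by the highest bit in which it differs from the
    last extracted key.  All vertices are kept in one array sorted by bucket, so
    that a vertex moves to the next lower bucket by one swap.  It does so O(log n)
    times, which pays for everything but the inspection of the edges.
    Unreached vertices have the key INF = 2^D and are treated like the others. *)

Set Implicit Arguments.
Unset Strict Implicit.
Unset Printing Implicit Defensive.

Local Open Scope nat_scope.

(** * A structured language *)

Inductive cmd :=
| Skip
| Ins (i : instr)
| Seq (c1 c2 : cmd)
| If (r : nat) (c1 c2 : cmd)
| While (r : nat) (c : cmd).

Declare Scope cmd_scope.
Delimit Scope cmd_scope with cmd.
Notation "c1 ;; c2" := (Seq c1 c2) (at level 60, right associativity) : cmd_scope.
Coercion Ins : instr >-> cmd.
Local Open Scope cmd_scope.
Local Open Scope nat_scope.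

Section Exec.

Variables (S : Type) (iok : instr -> S -> Prop) (istp : instr -> S -> S).
Variables (rok : nat -> bool) (getr : S -> nat -> nat) (bump : S -> S).

Inductive exec : cmd -> S -> S -> Prop :=
| XSkip s : exec Skip s s
| XIns i s : iok i s -> exec (Ins i) s (istp i s)
| XSeq c1 c2 s s1 s2 : exec c1 s s1 -> exec c2 s1 s2 -> exec (Seq c1 c2) s s2
| XIf r c1 c2 s s' : rok r ->
    exec (if getr s r == 0 then c2 else c1) (bump s) s' ->
    exec (If r c1 c2) s (bump s')
| XWhile0 r c s : rok r -> getr s r = 0 -> exec (While r c) s (bump s)
| XWhile1 r c s s1 s2 : rok r -> getr s r <> 0 ->
    exec c (bump s) s1 -> exec (While r c) (bump s1) s2 ->
    exec (While r c) s s2.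

Definition run (c : cmd) (s : S) (Q : S -> Prop) : Prop :=
  exists2 s', exec c s s' & Q s'.

Lemma run_conseq c s (Q Q' : S -> Prop) :
  run c s Q -> (forall s', Q s' -> Q' s') -> run c s Q'.
Proof. by case=> s' X q H; exists s' => //; apply: H. Qed.

Lemma run_skip s (Q : S -> Prop) : Q s -> run Skip s Q.
Proof. by move=> q; exists s => //; apply: XSkip. Qed.

Lemma run_ins i s (Q : S -> Prop) :
  iok i s -> Q (istp i s) -> run (Ins i) s Q.
Proof. by move=> ok q; exists (istp i s) => //; apply: XIns. Qed.

Lemma run_seq c1 c2 s (Q : S -> Prop) :
  run c1 s (fun s1 => run c2 s1 Q) -> run (Seq c1 c2) s Q.
Proof.
by case=> s1 X1 [s2 X2 q]; exists s2 => //; apply: XSeq X1 X2.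
Qed.

Lemma run_if r c1 c2 s (Q : S -> Prop) : rok r ->
  run (if getr s r == 0 then c2 else c1) (bump s) (fun s' => Q (bump s')) ->
  run (If r c1 c2) s Q.
Proof. by move=> rr [s' X q]; exists (bump s') => //; apply: XIf. Qed.

Lemma run_while (I : nat -> S -> Prop) r c (Q : S -> Prop) : rok r ->
  (forall k s, I k s -> getr s r <> 0 ->
     run c (bump s) (fun s' => exists2 k', k' < k & I k' (bump s'))) ->
  (forall k s, I k s -> getr s r = 0 -> Q (bump s)) ->
  forall k s, I k s -> run (While r c) s Q.
Proof.
move=> rr Hbody Hexit k; elim/ltn_ind: k => k IH s Is.
case: (getr s r =P 0) => [r0|r1].
  by exists (bump s); [apply: XWhile0 | apply: Hexit r0; apply: Is].
have [s1 X1 [k' lt_k' Is1]] := Hbody _ _ Is r1.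
have [s2 X2 q] := IH _ lt_k' _ Is1.
by exists s2 => //; apply: XWhile1 X2.
Qed.

End Exec.

(** * Compilation *)

Definition control (i : instr) : bool :=
  match i with Jump _ | JumpZ _ _ | Halt => true | _ => false end.

Fixpoint csize (c : cmd) : nat :=
  match c with
  | Skip => 0
  | Ins _ => 1
  | Seq c1 c2 => csize c1 + csize c2
  | If _ c1 c2 => csize c1 + csize c2 + 3
  | While _ c => csize c + 2
  end.

Fixpoint comp (o : nat) (c : cmd) : program :=
  match c with
  | Skip => [::]
  | Ins i => [:: i]
  | Seq c1 c2 => comp o c1 ++ comp (o + csize c1) c2
  | If r c1 c2 =>
      let e := o + (csize c1 + csize c2 + 3) in
      (JumpZ r (o.+1 + csize c1).+1 :: comp o.+1 c1 ++ [:: Jump e])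
      ++ comp (o.+1 + csize c1).+1 c2 ++ [:: Jump e]
  | While r c =>
      JumpZ r (o + (csize c + 2)) :: comp o.+1 c ++ [:: Jump o]
  end.

Lemma size_comp o c : size (comp o c) = csize c.
Proof.
elim: c o => //= [c1 IH1 c2 IH2 | r c1 IH1 c2 IH2 | r c IH] o.
- by rewrite size_cat IH1 IH2.
- by rewrite !size_cat /= IH1 IH2 /=; lia.
- by rewrite size_cat /= IH /=; lia.
Qed.

Fixpoint code_at (P : program) (o : nat) (c : cmd) : Prop :=
  match c with
  | Skip => True
  | Ins i => nth Halt P o = i
  | Seq c1 c2 => code_at P o c1 /\ code_at P (o + csize c1) c2
  | If r c1 c2 =>
      let e := o + (csize c1 + csize c2 + 3) in
      [/\ nth Halt P o = JumpZ r (o.+1 + csize c1).+1,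
          code_at P o.+1 c1, nth Halt P (o.+1 + csize c1) = Jump e,
          code_at P (o.+1 + csize c1).+1 c2
        & nth Halt P ((o.+1 + csize c1).+1 + csize c2) = Jump e]
  | While r c =>
      [/\ nth Halt P o = JumpZ r (o + (csize c + 2)), code_at P o.+1 c
        & nth Halt P (o.+1 + csize c) = Jump o]
  end.

Lemma code_at_comp c P1 P2 o :
  size P1 = o -> code_at (P1 ++ comp o c ++ P2) o c.
Proof.
elim: c P1 P2 o => //= [i|c1 IH1 c2 IH2|r c1 IH1 c2 IH2|r c IH] P1 P2 o sz.
- by rewrite nth_cat sz ltnn subnn.
- have E : P1 ++ (comp o c1 ++ comp (o + csize c1) c2) ++ P2 =
           (P1 ++ comp o c1) ++ comp (o + csize c1) c2 ++ P2 by rewrite !catA.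
  split; last by rewrite E; apply: IH2; rewrite size_cat size_comp sz.
  by rewrite -(catA (comp o c1)); apply: IH1.
- set e := o + (_ + 3); set z := JumpZ _ _.
  set C1 := comp _ c1; set C2 := comp _ c2.
  have s1 : size C1 = csize c1 by rewrite size_comp.
  have s2 : size C2 = csize c2 by rewrite size_comp.
  have E1 : P1 ++ (z :: (C1 ++ [:: Jump e]) ++ C2 ++ [:: Jump e]) ++ P2 =
            rcons P1 z ++ C1 ++ ([:: Jump e] ++ C2 ++ [:: Jump e] ++ P2).
    by rewrite -cats1 -?catA /= -?catA /= -?catA.
  have E2 : P1 ++ (z :: (C1 ++ [:: Jump e]) ++ C2 ++ [:: Jump e]) ++ P2 =
            (rcons P1 z ++ C1 ++ [:: Jump e]) ++ C2 ++ ([:: Jump e] ++ P2).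
    by rewrite -cats1 -?catA /= -?catA /= -?catA.
  split.
  + by rewrite nth_cat sz ltnn subnn.
  + by rewrite E1; apply: IH1; rewrite size_rcons sz.
  + rewrite E1 nth_cat size_rcons sz ltnNge leq_addr /=.
    by rewrite nth_cat s1 addKn ltnn subnn.
  + by rewrite E2; apply: IH2; rewrite !size_cat size_rcons s1 sz /=; lia.
  + rewrite E2 nth_cat !size_cat size_rcons s1 sz /=.
    have -> : (o.+1 + csize c1).+1 + csize c2 < o.+1 + (csize c1 + 1) = false.
      by apply/negP; lia.
    rewrite nth_cat s2.
    have -> : (o.+1 + csize c1).+1 + csize c2 - (o.+1 + (csize c1 + 1)) = csize c2.
      by lia.
    by rewrite ltnn subnn.
- set z := JumpZ _ _; set C := comp _ c.
  have s1 : size C = csize c by rewrite size_comp.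
  have E1 : P1 ++ (z :: C ++ [:: Jump o]) ++ P2 =
            rcons P1 z ++ C ++ ([:: Jump o] ++ P2).
    by rewrite -cats1 -?catA /= -?catA.
  split.
  + by rewrite nth_cat sz ltnn subnn.
  + by rewrite E1; apply: IH; rewrite size_rcons sz.
  + rewrite E1 nth_cat size_rcons sz ltnNge leq_addr /=.
    by rewrite nth_cat s1 addKn ltnn subnn.
Qed.

Definition setpc (l : nat) (s : config) : config :=
  let: Config _ r m t sp os := s in Config l r m t sp os.

Section Machine.

Variables (W : nat) (input : nat -> nat).

(* The program counter of a state of the structured language is meaningless. *)
Definition lstp (i : instr) (s : config) : config :=
  let: Config pc r m t sp os := s in
  match i with
  | Const d k => Config pc (upd r d (k %% 2 ^ W)) m t.+1 sp os
  | Move d a => Config pc (upd r d (r a)) m t.+1 sp os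
  | Bin o d a b =>
      Config pc (upd r d (eval_binop W o (r a) (r b))) m t.+1 sp os
  | Read d a => Config pc (upd r d (m (r a))) m t.+1 (maxn sp (r a).+1) os
  | Write a b => Config pc r (upd m (r a) (r b)) t.+1 (maxn sp (r a).+1) os
  | Input d a => Config pc (upd r d (input (r a))) m t.+1 sp os
  | Emit u v d =>
      Config pc r m t.+1 sp (rcons os (t.+1, (r u, r v, Some (r d))))
  | EmitInf u v =>
      Config pc r m t.+1 sp (rcons os (t.+1, (r u, r v, None)))
  | _ => s
  end.

Definition lok (i : instr) (s : config) : Prop := ~~ control i.

Definition lbump (s : config) : config :=
  let: Config pc r m t sp os := s in Config pc r m t.+1 sp os.

Definition lexec := exec lok lstp xpredT reg lbump.
Definition lrun := run lok lstp xpredT reg lbump.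

Lemma lexec_used c s s' : lexec c s s' -> used s <= used s'.
Proof.
have bu s0 : used (lbump s0) = used s0 by case: s0.
elim=> {c s s'}.
- by [].
- by case=> [d k|d a|o d a b|d a|a b|d a|l|a l|u v d|u v|] [pc r m t sp os] //= _;
     rewrite leq_maxl.
- by move=> c1 c2 s s1 s2 _ H1 _; apply: leq_trans.
- by move=> r c1 c2 s s' _ _; rewrite !bu.
- by move=> *; rewrite bu.
- move=> r c s s1 s2 _ _ _ H1 _; rewrite !bu in H1 *.
  exact: leq_trans.
Qed.

Variable P : program.

Definition reach (s s' : config) : Prop :=
  exists t, iter t (obind (step W P input)) (Some s) = Some s'.

Lemma reach_refl s : reach s s.
Proof. by exists 0. Qed.

Lemma reach_step s s' : step W P input s = Some s' -> reach s s'.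
Proof. by move=> H; exists 1. Qed.

Lemma reach_trans s1 s2 s3 : reach s1 s2 -> reach s2 s3 -> reach s1 s3.
Proof. by case=> t H [t' H']; exists (t' + t); rewrite iterD H. Qed.

Lemma comp_correct c s s' o : lexec c s s' -> code_at P o c ->
  reach (setpc o s) (setpc (o + csize c) s').
Proof.
have sj l pc s0 : nth Halt P pc = Jump l ->
    reach (setpc pc s0) (setpc l (lbump s0)).
  by move=> E; apply: reach_step; case: s0 => *; rewrite /= E.
have sz r l pc s0 : nth Halt P pc = JumpZ r l ->
    reach (setpc pc s0) (setpc (if reg s0 r == 0 then l else pc.+1) (lbump s0)).
  by move=> E; apply: reach_step; case: s0 => *; rewrite /= E.
move=> X; elim: X o => {c s s'} /=.
- by move=> s o _; rewrite addn0; apply: reach_refl.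
- move=> i [pc r m t sp os] ok o E; apply: reach_step; rewrite addn1 /= E.
  by case: i ok {E}.
- move=> c1 c2 s s1 s2 _ IH1 _ IH2 o [H1 H2].
  by apply: reach_trans (IH1 _ H1) _; rewrite addnA; apply: IH2.
- move=> r c1 c2 s s' _ _ IH o [E1 H1 E2 H2 E3].
  apply: reach_trans (sz _ _ _ _ E1) _.
  case: eqP IH => _ IH.
    by apply: reach_trans (IH _ H2) _; apply: sj.
  by apply: reach_trans (IH _ H1) _; apply: sj.
- move=> r c s _ r0 o [E1 _ _].
  by apply: reach_trans (sz _ _ _ _ E1) _; rewrite r0; apply: reach_refl.
- move=> r c s s1 s2 _ /eqP/negbTE r1 _ IH1 _ IH2 o H; have [E1 H1 E2] := H.
  apply: reach_trans (sz _ _ _ _ E1) _; rewrite r1.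
  apply: reach_trans (IH1 _ H1) _.
  by apply: reach_trans (sj _ _ _ E2) _; apply: IH2.
Qed.

Lemma halts_with_uniq mem0 s s' :
  halts_with W P input mem0 s -> halts_with W P input mem0 s' -> s = s'.
Proof.
set F := obind (step W P input).
have stuck t a : step W P input a = None ->
    iter t F (Some a) = Some a \/ iter t F (Some a) = None.
  move=> N; elim: t => [|t [H|H]]; first by left.
    by right; rewrite iterS H.
  by right; rewrite iterS H.
have gen t t' a b : t <= t' -> iter t F (Some (init mem0)) = Some a ->
    step W P input a = None -> iter t' F (Some (init mem0)) = Some b -> a = b.
  move=> le_t Ha Na; rewrite -(subnK le_t) iterD Ha.
  by case: (stuck (t' - t) _ Na) => -> // [].
case=> [[t Ht] Nt] [[t' Ht'] Nt'].
by case: (leqP t t') => [|/ltnW] le_t; [|symmetry]; apply: gen le_t _ _ _.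
Qed.

End Machine.

Lemma comp_halts W input c mem0 s : lexec W input c (init mem0) s ->
  halts_with W (comp 0 c) input mem0 (setpc (csize c) s).
Proof.
move=> X; split.
  have := @comp_correct W input (comp 0 c) c (init mem0) s 0 X.
  have := @code_at_comp c [::] [::] 0 erefl; rewrite cats0 => ca /(_ ca).
  by rewrite add0n.
by case: s {X} => pc r m t sp os /=; rewrite nth_default // size_comp.
Qed.

(** * Word arithmetic *)

Section Eval.

Variable W : nat.

Lemma ev_add x y : x + y < 2 ^ W -> eval_binop W OpAdd x y = x + y.
Proof. exact: modn_small. Qed.

Lemma ev_sub x y : y <= x -> x < 2 ^ W -> eval_binop W OpSub x y = x - y.
Proof.
by move=> le_yx lt_x; rewrite /eval_binop addnC -addnBA // modnDl modn_small //; lia.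
Qed.

Lemma ev_mul x y : x * y < 2 ^ W -> eval_binop W OpMul x y = x * y.
Proof. exact: modn_small. Qed.

Lemma ev_div x y : x < 2 ^ W -> eval_binop W OpDiv x y = x %/ y.
Proof. by move=> H; apply: modn_small; apply: leq_ltn_trans (leq_div _ _) H. Qed.

Lemma ev_mod x y : x < 2 ^ W -> eval_binop W OpMod x y = x %% y.
Proof. by move=> H; apply: modn_small; apply: leq_ltn_trans (leq_mod _ _) H. Qed.

Lemma ev_shl x y : x * 2 ^ y < 2 ^ W -> eval_binop W OpShl x y = x * 2 ^ y.
Proof. exact: modn_small. Qed.

Lemma ev_shr x y : x < 2 ^ W -> eval_binop W OpShr x y = x %/ 2 ^ y.
Proof. by move=> H; apply: modn_small; apply: leq_ltn_trans (leq_div _ _) H. Qed.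

Lemma ev_lt x y : 1 < 2 ^ W -> eval_binop W OpLt x y = (x < y).
Proof. by move=> H; apply: modn_small; case: (x < y) => //; apply: ltnW. Qed.

Lemma ev_eq x y : 1 < 2 ^ W -> eval_binop W OpEq x y = (x == y).
Proof. by move=> H; apply: modn_small; case: (x == y) => //; apply: ltnW. Qed.

End Eval.

Lemma upd_far f k x i b : i < b -> b <= k -> upd f k x i = f i.
Proof. by move=> h1 h2; rewrite /upd; case: eqP => // ?; lia. Qed.

(** * Source programs *)

(* [tm] counts the instructions, tests and jumps; it is the number of ticks of
   the instrumented program. *)
Record st := St { rg : nat -> nat; mm : nat -> nat; tm : nat }.

Definition sbump (s : st) : st := St (rg s) (mm s) (tm s).+1.

Definition srok (r : nat) : bool := 10 <= r.

Section Source.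

Variables (W : nat) (input : nat -> nat) (Sp ob n : nat).

Definition sstp (i : instr) (s : st) : st :=
  let: St r m t := s in
  match i with
  | Const d k => St (upd r d (k %% 2 ^ W)) m t.+1
  | Move d a => St (upd r d (r a)) m t.+1
  | Bin o d a b => St (upd r d (eval_binop W o (r a) (r b))) m t.+1
  | Read d a => St (upd r d (m (r a))) m t.+1
  | Write a b => St r (upd m (r a) (r b)) t.+1
  | Input d a => St (upd r d (input (r a))) m t.+1
  | _ => s
  end.

(* Registers below 10 belong to the enumeration of the pending outputs, those
   below 20 are constants of the current phase, and the cells of
   [ob, ob + n) hold the pending outputs. *)
Definition siok (i : instr) (s : st) : Prop :=
  match i with
  | Const d _ => 20 <= d
  | Move d a | Input d a => (20 <= d) && (10 <= a)
  | Bin _ d a b => [&& 20 <= d, 10 <= a & 10 <= b]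
  | Read d a => [&& 20 <= d, 10 <= a & rg s a < Sp]
  | Write a b => [&& 10 <= a, 10 <= b, rg s a < Sp & ~~ (ob <= rg s a < ob + n)]
  | _ => false
  end.

Definition srun := run siok sstp srok rg sbump.
Definition sexec := exec siok sstp srok rg sbump.

Lemma sexec_tm c s s' : sexec c s s' -> tm s <= tm s'.
Proof.
elim=> {c s s'} //=.
- by case=> [d k|d a|o d a b|d a|a b|d a|l|a l|u v d|u v|] [r m t] //= _.
- by move=> c1 c2 s s1 s2 _ H1 _; apply: leq_trans.
- by move=> r c1 c2 s s' _ _ /ltnW h; apply: leqW.
- by move=> r c s s1 s2 _ _ _ /ltnW H1 _ /ltnW; apply: leq_trans.
Qed.

Lemma srun_tm c s (Q : st -> Prop) :
  srun c s (fun s' => tm s <= tm s' -> Q s') -> srun c s Q.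
Proof. by case=> s' X q; exists s' => //; apply: q; apply: sexec_tm X. Qed.

Lemma r_const d k v r m t (Q : st -> Prop) : 20 <= d -> k = v -> v < 2 ^ W ->
  Q (St (upd r d v) m t.+1) -> srun (Const d k) (St r m t) Q.
Proof. by move=> hd -> hv q; apply: run_ins; rewrite //= modn_small. Qed.

Lemma r_move d a v r m t (Q : st -> Prop) : (20 <= d) && (10 <= a) -> r a = v ->
  Q (St (upd r d v) m t.+1) -> srun (Move d a) (St r m t) Q.
Proof. by move=> hd <- q; apply: run_ins. Qed.

Lemma r_bin o d a b x y v r m t (Q : st -> Prop) :
  [&& 20 <= d, 10 <= a & 10 <= b] -> r a = x -> r b = y ->
  eval_binop W o x y = v ->
  Q (St (upd r d v) m t.+1) -> srun (Bin o d a b) (St r m t) Q.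
Proof. by move=> hd <- <- <- q; apply: run_ins. Qed.

Lemma r_read d a x v r m t (Q : st -> Prop) :
  (20 <= d) && (10 <= a) -> r a = x -> x < Sp -> m x = v ->
  Q (St (upd r d v) m t.+1) -> srun (Read d a) (St r m t) Q.
Proof.
by move=> /andP[h1 h2] <- h <- q; apply: run_ins => //=; rewrite h1 h2.
Qed.

Lemma r_input d a x v r m t (Q : st -> Prop) :
  (20 <= d) && (10 <= a) -> r a = x -> input x = v ->
  Q (St (upd r d v) m t.+1) -> srun (Input d a) (St r m t) Q.
Proof. by move=> hd <- <- q; apply: run_ins. Qed.

Lemma r_write a b x y r m t (Q : st -> Prop) :
  (10 <= a) && (10 <= b) -> r a = x -> r b = y ->
  x < Sp -> ~~ (ob <= x < ob + n) ->
  Q (St r (upd m x y) t.+1) -> srun (Write a b) (St r m t) Q.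
Proof.
by move=> /andP[h1 h2] <- <- hs ho q; apply: run_ins => //=; rewrite h1 h2 hs.
Qed.

End Source.

Ltac lk :=
  rewrite /upd /=;
  lazymatch goal with
  | |- ?f ?k = _ => first [is_var f; eassumption | reflexivity]
  | _ => reflexivity
  end.
Ltac sq := try apply: run_seq.
Ltac sbin L := sq; eapply r_bin; [done | lk | lk | apply: L; try lia | ].
Ltac sread := sq; eapply r_read; [done | lk | try lia | | ].
Ltac swrite := sq; eapply r_write; [done | lk | lk | try lia | try lia | ].

(** * The radix heap *)

(* Registers: 10 the constant 1; 11 n; 12 INF; 13-17 the base addresses of the
   arrays of keys, [bk], [pm], [ps] and [S]; 18 the top bucket; 19 the source;
   20 the last extracted key; 40 and 41 the vertex to be moved and its key. *)
Definition MD : cmd :=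
  Bin OpAdd 70 14 40 ;; Read 71 70 ;; Bin OpSub 72 71 10 ;; Write 70 72 ;;
  Bin OpAdd 70 17 71 ;; Read 73 70 ;; Bin OpAdd 72 73 10 ;; Write 70 72 ;;
  Bin OpAdd 70 15 73 ;; Read 74 70 ;; Write 70 40 ;;
  Bin OpAdd 70 16 40 ;; Read 75 70 ;; Write 70 73 ;;
  Bin OpAdd 70 15 75 ;; Write 70 74 ;;
  Bin OpAdd 70 16 74 ;; Write 70 75.

Definition COND : cmd :=
  Bin OpAdd 60 14 40 ;; Read 61 60 ;; Bin OpLt 62 10 61 ;;
  If 62 (Bin OpSub 61 61 10 ;; Bin OpSub 61 61 10 ;;
         Bin OpShr 63 41 61 ;; Bin OpShr 64 20 61 ;; Bin OpEq 62 63 64)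
        Skip.

Definition SIFT : cmd := COND ;; While 62 (MD ;; COND).

(* A key [x >= last] lies in bucket [b >= 1] iff [x] and [last] agree up to
   their [b - 1] lowest bits, but not up to their [b - 2] lowest ones. *)
Definition upp (last x b : nat) : Prop := x %/ 2 ^ b.-1 = last %/ 2 ^ b.-1.
Definition mov (last x b : nat) : bool :=
  (1 < b) && (x %/ 2 ^ (b - 2) == last %/ 2 ^ (b - 2)).
Definition exa (last x b : nat) : Prop := ~~ mov last x b.

Lemma mov_upp last x b : mov last x b -> 1 < b /\ upp last x b.-1.
Proof.
by case/andP=> h1 /eqP h2; split=> //; rewrite /upp; have -> : b.-1.-1 = b - 2 by lia.
Qed.

Section Heap.

Variables (W : nat) (input : nat -> nat) (n TOP kb ob INF Sp : nat).
Hypothesis n_gt0 : 0 < n.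
Hypothesis kbob : (kb = 0 /\ ob = n) \/ (kb = n /\ ob = 0).
Hypothesis Sp_big : 5 * n + TOP + 1 < Sp.
Hypothesis Sp_word : Sp < 2 ^ W.

Notation srun := (srun W input Sp ob n).

Definition env (r : nat -> nat) : Prop :=
  [/\ r 10 = 1, r 11 = n, r 12 = INF, r 13 = kb
    & [/\ r 14 = 2 * n, r 15 = 3 * n, r 16 = 4 * n, r 17 = 5 * n & r 18 = TOP]].

Lemma env_eq (r r' : nat -> nat) :
  (forall i, i < 20 -> r' i = r i) -> env r -> env r'.
Proof. by move=> E; rewrite /env !E. Qed.

Record rep (m key bk pm ps S : nat -> nat) : Prop := Rep {
  rep_key : forall i, i < n -> m (kb + i) = key i;
  rep_bk : forall i, i < n -> m (2 * n + i) = bk i;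
  rep_pm : forall i, i < n -> m (3 * n + i) = pm i;
  rep_ps : forall i, i < n -> m (4 * n + i) = ps i;
  rep_S : forall b, b <= TOP.+1 -> m (5 * n + b) = S b }.

Ltac rep_upd := case=> h1 h2 h3 h4 h5 hi; split=> j hj; rewrite /upd;
  do 2?[case: eqP]; intros; subst; solve [lia | auto].

Lemma rep_upd_key m key bk pm ps S i x : rep m key bk pm ps S -> i < n ->
  rep (upd m (kb + i) x) (upd key i x) bk pm ps S.
Proof. rep_upd. Qed.

Lemma rep_upd_bk m key bk pm ps S i x : rep m key bk pm ps S -> i < n ->
  rep (upd m (2 * n + i) x) key (upd bk i x) pm ps S.
Proof. rep_upd. Qed.

Lemma rep_upd_pm m key bk pm ps S i x : rep m key bk pm ps S -> i < n ->
  rep (upd m (3 * n + i) x) key bk (upd pm i x) ps S.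
Proof. rep_upd. Qed.

Lemma rep_upd_ps m key bk pm ps S i x : rep m key bk pm ps S -> i < n ->
  rep (upd m (4 * n + i) x) key bk pm (upd ps i x) S.
Proof. rep_upd. Qed.

Lemma rep_upd_S m key bk pm ps S i x : rep m key bk pm ps S -> i <= TOP.+1 ->
  rep (upd m (5 * n + i) x) key bk pm ps (upd S i x).
Proof. rep_upd. Qed.

(* [pm] lists the vertices by increasing bucket [bk], [ps] is its inverse, and
   [S b] is the position at which bucket [b] starts. *)
Record parr (bk pm ps S : nat -> nat) : Prop := Parr {
  pmK : forall i, i < n -> pm i < n /\ ps (pm i) = i;
  psK : forall v, v < n -> ps v < n /\ pm (ps v) = v;
  bk_le : forall v, v < n -> bk v <= TOP;
  S_n : forall b, b <= TOP.+1 -> S b <= n;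
  S_le : forall v b, v < n -> b <= TOP.+1 -> (S b <= ps v) = (b <= bk v) }.

Lemma S_first bk pm ps S v : parr bk pm ps S -> v < n ->
  S (bk v) < n /\ bk (pm (S (bk v))) = bk v.
Proof.
move=> H hv; have hb := bk_le H hv.
have [hp _] := psK H hv.
have h1 : S (bk v) <= ps v by rewrite (S_le H) //; lia.
have h2 : ~~ (S (bk v).+1 <= ps v) by rewrite (S_le H) //; lia.
have hS : S (bk v) < n by lia.
split=> //; have [hw pw] := pmK H hS.
have h3 : (S (bk v) <= ps (pm (S (bk v)))) by rewrite pw.
have h4 : ~~ (S (bk v).+1 <= ps (pm (S (bk v)))) by rewrite pw; lia.
rewrite (S_le H) // in h3; last by lia.
rewrite (S_le H) // in h4; lia.
Qed.

Lemma parr_movedown bk pm ps S v : parr bk pm ps S -> v < n -> 0 < bk v ->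
  let b := bk v in let s := S b in let w := pm s in let p := ps v in
  parr (upd bk v b.-1) (upd (upd pm s v) p w) (upd (upd ps v s) w p)
       (upd S b s.+1).
Proof.
move=> H hv b0 b s w p.
have [hs bw] := S_first H hv; rewrite -/b -/s -/w in hs bw.
have [hw pw] := pmK H hs; rewrite -/w in hw pw.
have [hp vp] := psK H hv; rewrite -/p in hp vp.
have hb : b <= TOP := bk_le H hv.
have sp : s <= p by rewrite (S_le H) //; lia.
have e1 : w = v -> s = p by move=> E; rewrite -pw E.
have e2 : s = p -> w = v by move=> E; rewrite /w E.
split=> [i hi|z hz|z hz|b' hb'|z b' hz hb'].
- have [hz zi] := pmK H hi.
  rewrite /upd; case: (i =P p) => [->|ip].
    by rewrite eqxx.
  case: (i =P s) => [->|is_]; last first.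
    split=> //; case: (pm i =P w) => [E|_]; first by move: zi; rewrite E pw; lia.
    by case: (pm i =P v) => [E|//]; move: zi; rewrite E -/p; lia.
  split=> //; case: (v =P w) => [E|_]; last by rewrite eqxx.
  by rewrite e1.
- have [hpz zp] := psK H hz.
  rewrite /upd; case: (z =P w) => [->|zw].
    by rewrite eqxx.
  case: (z =P v) => [->|zv].
    split=> //; case: (s =P p) => [E|_]; last by rewrite eqxx.
    exact: e2.
  split=> //; case: (ps z =P p) => [E|_]; first by case: zv; rewrite -zp E.
  by case: (ps z =P s) => [E|//]; case: zw; rewrite -zp E.
- rewrite /upd; case: (z =P v) => [_|_]; first by lia.
  exact: (bk_le H hz).
- by rewrite /upd; case: eqP => // _; apply: (S_n H).
- rewrite /upd.
  have Sv c : c <= TOP.+1 -> (S c <= p) = (c <= b).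
    by move=> hc; rewrite (S_le H).
  have Sw c : c <= TOP.+1 -> (S c <= s) = (c <= b).
    by move=> hc; rewrite -pw (S_le H) // bw.
  have Sz := S_le H hz hb'.
  case: (z =P w) => [zw|zw]; case: (z =P v) => [zv|zv]; case: (b' =P b) => [bb|bb].
  + have := e1 (etrans (esym zw) zv); lia.
  + rewrite Sv //; lia.
  + have : s <> p by move=> /e2; rewrite -zw.
    by rewrite zw bw; lia.
  + by rewrite Sv // zw bw.
  + lia.
  + rewrite Sw //; lia.
  + have : ps z <> s.
      by move=> E; case: zw; rewrite -(proj2 (psK H hz)) E.
    by rewrite bb in Sz *; rewrite -Sz -/s; lia.
  + exact: Sz.
Qed.

Lemma run_MD r m t key bk pm ps S v (Q : st -> Prop) :
  env r -> rep m key bk pm ps S -> parr bk pm ps S ->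
  r 40 = v -> v < n -> 0 < bk v ->
  (forall r' m' bk' pm' ps' S', (forall i, i < 70 -> r' i = r i) ->
     rep m' key bk' pm' ps' S' -> parr bk' pm' ps' S' ->
     bk' = upd bk v (bk v).-1 -> Q (St r' m' (t + 18))) ->
  srun MD (St r m t) Q.
Proof.
move=> [E10 E11 E12 E13 [E14 E15 E16 E17 E18]] R H E40 hv b0 HQ.
have Hmd := parr_movedown H hv b0; rewrite /= in Hmd.
have hb := bk_le H hv; have [hp vp] := psK H hv.
have [hs bw] := S_first H hv.
have [hw pw] := pmK H hs.
sbin ev_add; sread; first exact: (rep_bk R hv).
sbin ev_sub; swrite.
move: (rep_upd_bk (bk v - 1) R hv) => {}R.
sbin ev_add; sread; first by apply: (rep_S R); lia.
sbin ev_add; swrite.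
have {}R := rep_upd_S (S (bk v) + 1) R (leqW hb).
sbin ev_add; sread; first by apply: (rep_pm R).
swrite; have {}R := rep_upd_pm v R hs.
sbin ev_add; sread; first by apply: (rep_ps R).
swrite; have {}R := rep_upd_ps (S (bk v)) R hv.
sbin ev_add; swrite; have {}R := rep_upd_pm (pm (S (bk v))) R hp.
sbin ev_add; swrite; have {}R := rep_upd_ps (ps v) R hw.
rewrite -[X in St _ _ X](_ : t + 18 = _); last by lia.
apply: HQ R _ _.
- by move=> i hi; rewrite !(upd_far _ _ hi).
- by rewrite addn1 subn1.
- by rewrite subn1.
Qed.

Lemma run_COND r m t key bk pm ps S v x last (Q : st -> Prop) :
  env r -> rep m key bk pm ps S -> parr bk pm ps S ->
  r 40 = v -> v < n -> r 41 = x -> r 20 = last -> x < 2 ^ W -> last < 2 ^ W ->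
  (forall r' t', (forall i, i < 60 -> r' i = r i) ->
     r' 62 = mov last x (bk v) ->
     t' <= t + 10 -> Q (St r' m t')) ->
  srun COND (St r m t) Q.
Proof.
move=> [E10 E11 E12 E13 [E14 E15 E16 E17 E18]] R H E40 hv E41 E20 hx hl HQ.
have hb := bk_le H hv.
sbin ev_add; sread; first exact: (rep_bk R hv).
sbin ev_lt; apply: run_if => //=.
rewrite {1}/upd /=; case: ltnP => hb1 /=; last first.
  apply: run_skip; apply: HQ => /=; [| |lia].
  - by move=> i hi; rewrite !(upd_far _ _ hi).
  - by rewrite /upd /mov /= ltnNge hb1.
rewrite /sbump /=.
sbin ev_sub; sbin ev_sub; sbin ev_shr; sbin ev_shr; sbin ev_eq.
apply: HQ => /=; [| |lia].
- by move=> i hi; rewrite !(upd_far _ _ hi).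
- by rewrite /upd /mov /= hb1 -subnDA.
Qed.

Lemma run_SIFT r m t key bk pm ps S v x last (Q : st -> Prop) :
  env r -> rep m key bk pm ps S -> parr bk pm ps S ->
  r 40 = v -> v < n -> r 41 = x -> r 20 = last -> x < 2 ^ W -> last < 2 ^ W ->
  0 < bk v -> upp last x (bk v) ->
  (forall r' m' t' bk' pm' ps' S', (forall i, i < 60 -> r' i = r i) ->
     rep m' key bk' pm' ps' S' -> parr bk' pm' ps' S' ->
     (forall z, z <> v -> bk' z = bk z) ->
     0 < bk' v <= bk v -> upp last x (bk' v) -> exa last x (bk' v) ->
     t' + 30 * bk' v <= t + 30 * bk v + 11 -> Q (St r' m' t')) ->
  srun SIFT (St r m t) Q.
Proof.
move=> hE R H E40 hv E41 E20 hx hl b0 hu HQ.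
apply: run_seq; apply: (run_COND hE R H E40 hv E41 E20 hx hl) => r1 t1 Er E62 ht1.
pose I k (s : st) := exists bk' pm' ps' S',
  [/\ rep (mm s) key bk' pm' ps' S' /\ parr bk' pm' ps' S',
      (forall i, i < 60 -> rg s i = r i) /\ (forall z, z <> v -> bk' z = bk z),
      0 < bk' v <= bk v /\ upp last x (bk' v),
      rg s 62 = mov last x (bk' v)
    & k = bk' v /\ tm s + 30 * bk' v <= t + 30 * bk v + 10].
apply: (run_while (I := I) _ _ _ (k := bk v)) => //; last first.
  exists bk, pm, ps, S; do 2!split=> //=; lia.
- move=> k [r2 m2 t2] [bk' [pm' [ps' [S' [/= [R' H'] [Er' Eb'] [hb' hu'] E62' [_ ht']]]]]] E0.
  rewrite /sbump /=; apply: (HQ _ _ _ _ _ _ _ Er' R' H' Eb' hb' hu'); last by lia.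
  by rewrite /exa; move: E62'; rewrite E0; case: mov.
- move=> k [r2 m2 t2] [bk' [pm' [ps' [S' [/= [R' H'] [Er' Eb'] [hb' hu'] E62' [-> ht']]]]]] E0.
  have hE2 : env r2 by apply: env_eq hE => i hi; apply: Er'; lia.
  have [h1 h2] : 1 < bk' v /\ upp last x (bk' v).-1.
    by apply: mov_upp; move: E0; rewrite E62'; case: mov.
  have E40' : r2 40 = v by rewrite Er'.
  apply: run_seq; apply: (run_MD hE2 R' H' E40' hv); first by lia.
  move=> r3 m3 bk3 pm3 ps3 S3 Er3 R3 H3 Eb3.
  have hE3 : env r3 by apply: env_eq hE2 => i hi; apply: Er3; lia.
  have Er3' i : i < 60 -> r3 i = r i by move=> hi; rewrite Er3 ?Er' //; lia.
  have b3 : bk3 v = (bk' v).-1 by rewrite Eb3 /upd eqxx.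
  apply: (run_COND (v := v) (x := x) (last := last) hE3 R3 H3) => //.
  - by rewrite Er3' ?E40.
  - by rewrite Er3' ?E41.
  - by rewrite Er3' ?E20.
  move=> r4 t4 Er4 E4 /= ht4; exists (bk3 v); first by lia.
  exists bk3, pm3, ps3, S3; split=> //=.
  + split; first by move=> i hi; rewrite Er4 ?Er3'.
    by move=> z zv; rewrite Eb3 /upd; case: eqP => // _; apply: Eb'.
  + by split; [lia | rewrite b3].
  + split=> //; lia.
Qed.

End Heap.

(** * Dijkstra's algorithm *)

Definition RELAX : cmd :=
  Bin OpAdd 50 13 40 ;; Read 51 50 ;; Bin OpLt 52 41 51 ;;
  If 52 (Write 50 41 ;; SIFT) Skip.

Definition EDGES : cmd :=
  While 25 (Input 40 25 ;; Bin OpAdd 25 25 10 ;; Input 30 25 ;;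
            Bin OpAdd 25 25 10 ;; Input 25 25 ;; Bin OpAdd 41 20 30 ;; RELAX).

Definition SETTLE : cmd :=
  Move 40 22 ;; MD ;; Bin OpAdd 25 22 22 ;; Bin OpAdd 25 25 10 ;;
  Bin OpAdd 25 25 10 ;; Input 25 25 ;; EDGES.

Definition NONEMPTY : cmd :=
  Bin OpAdd 28 17 23 ;; Read 25 28 ;; Bin OpAdd 26 28 10 ;; Read 26 26 ;;
  Bin OpLt 27 25 26.

Definition REDIST : cmd :=
  Bin OpSub 29 23 10 ;; Bin OpSub 29 29 10 ;; Bin OpShr 30 20 29 ;;
  Bin OpAdd 30 30 10 ;; Bin OpShl 20 30 29 ;; NONEMPTY ;;
  While 27 (Bin OpAdd 28 15 25 ;; Read 40 28 ;; Bin OpAdd 28 13 40 ;;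
            Read 41 28 ;; SIFT ;; NONEMPTY).

Definition HEADK : cmd :=
  Bin OpAdd 28 17 10 ;; Read 21 28 ;; Bin OpLt 24 21 11.

Definition DIJK : cmd :=
  HEADK ;;
  While 24 (Bin OpAdd 28 15 21 ;; Read 22 28 ;; Bin OpAdd 28 14 22 ;;
            Read 23 28 ;; Bin OpLt 27 10 23 ;; If 27 REDIST SETTLE ;; HEADK).

Lemma upp_between last x y b :
  last <= x <= y -> upp last y b -> upp last x b.
Proof.
case/andP=> h1 h2; rewrite /upp => E; apply/eqP; rewrite eqn_leq -{1}E.
by rewrite !leq_div2r.
Qed.

Lemma divn_exp2D x a b : x %/ 2 ^ (a + b) = x %/ 2 ^ a %/ 2 ^ b.
Proof. by rewrite expnD divnMA. Qed.

Lemma upp_up last x b b' : b <= b' -> upp last x b -> upp last x b'.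
Proof.
move=> le_b; rewrite /upp => E.
have -> : b'.-1 = b.-1 + (b'.-1 - b.-1) by lia.
by rewrite !divn_exp2D E.
Qed.

Lemma odd_succ_half a b : b <= a -> a <> b -> a %/ 2 = b %/ 2 ->
  a = b.+1 /\ b.+1 %/ 2 = b %/ 2.
Proof. lia. Qed.

(* When bucket [b] is the lowest nonempty one, [last] jumps to the least key
   that may lie in it. *)
Definition jump last b := (last %/ 2 ^ (b - 2) + 1) * 2 ^ (b - 2).

Lemma jumpP last x b : 1 < b -> last <= x -> upp last x b -> exa last x b ->
  [/\ last <= jump last b, jump last b <= x, mov (jump last b) x b
    & upp last (jump last b) b].
Proof.
move=> b1; have -> : b = (b - 2).+2 by lia.
move: (b - 2) => e {b b1} le_lx; rewrite /upp /exa /mov /jump /= subSS subSS subn0.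
have q0 : 0 < 2 ^ e by rewrite expn_gt0.
rewrite -[e.+1]addn1 !divn_exp2D expn1 => E /= /negP N.
have [||E1 E2] := odd_succ_half _ _ E; first exact: leq_div2r.
  by move=> h; apply: N; rewrite h eqxx.
rewrite addn1 -E1; split.
- by rewrite E1; apply: ltnW; apply: ltn_ceil.
- exact: leq_trunc_div.
- by rewrite mulnK.
- by rewrite mulnK ?E1.
Qed.

Lemma jump_above last l' x b b' : 1 < b -> b < b' -> last <= x ->
  upp last l' b -> upp last x b' -> exa last x b' ->
  [/\ l' <= x, upp l' x b' & exa l' x b'].
Proof.
move=> b1 lt_b le_x Hl Hx Hex.
have Hl1 : upp last l' b'.-1 by apply: upp_up Hl; lia.
have Hl2 : upp last l' b' by apply: upp_up Hl; lia.
have e2 : b'.-1.-1 = b' - 2 by lia.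
have Hex' : exa l' x b'.
  by move: Hex Hl1; rewrite /exa /mov /upp e2 => + ->.
split=> //; last by rewrite /upp Hx Hl2.
move: Hex Hl1; rewrite /exa /mov /upp e2.
have -> : 1 < b' by lia.
move=> /= N E; rewrite leqNgt; apply/negP => lt_x; case/eqP: N.
apply/eqP; rewrite eqn_leq -{1}E !leq_div2r //; exact: ltnW.
Qed.

Section Dijkstra.

Variables (W : nat) (input : nat -> nat) (n TOP kb ob INF Sp : nat).
Variables (adj : nat -> seq (nat * nat)) (wmax s : nat).
Hypothesis n_gt0 : 0 < n.
Hypothesis kbob : (kb = 0 /\ ob = n) \/ (kb = n /\ ob = 0).
Hypothesis Sp_big : 5 * n + TOP + 1 < Sp.
Hypothesis Sp_word : Sp < 2 ^ W.
Hypothesis TOP_gt1 : 1 < TOP.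
Hypothesis INF_def : INF = 2 ^ (TOP - 2).
Hypothesis INF_word : INF + wmax < 2 ^ W.
Hypothesis s_lt : s < n.
Hypothesis adj_list : forall u, u < n ->
  list_at W input (input (u + u + 1 + 1)) (adj u).
Hypothesis adj_ok : forall u z w : nat, u < n -> (z, w) \in adj u -> z < n /\ w <= wmax.

Notation srun := (srun W input Sp ob n).
Notation env := (env n TOP kb INF).
Notation rep := (rep n TOP kb).
Notation parr := (parr n TOP).

Inductive dpath : nat -> nat -> Prop :=
| dpath0 : dpath s 0
| dpathS (u d z w : nat) : dpath u d -> (z, w) \in adj u -> dpath z (d + w).

Definition phi (v b : nat) : nat :=
  200 * b + (if b == 0 then 0 else 100 * size (adj v)).
Definition pot (bk : nat -> nat) : nat := \sum_(v < n) phi v (bk v).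

Lemma pot_upd1 bk bk' v : v < n -> (forall z, z <> v -> bk' z = bk z) ->
  pot bk' + phi v (bk v) = pot bk + phi v (bk' v).
Proof.
move=> hv E; rewrite /pot (bigD1 (Ordinal hv)) //= [in RHS](bigD1 (Ordinal hv)) //=.
rewrite (eq_bigr (fun i : 'I_n => phi i (bk i))) => [|i /eqP ne]; first by lia.
by rewrite E // => h; apply: ne; apply: val_inj.
Qed.

Lemma pot_lower bk bk' v : v < n -> (forall z, z <> v -> bk' z = bk z) ->
  0 < bk' v <= bk v -> pot bk' + 200 * bk v = pot bk + 200 * bk' v.
Proof.
move=> hv E hb; have := pot_upd1 hv E; rewrite /phi.
have -> : (bk v == 0) = false by apply/eqP; lia.
have -> : (bk' v == 0) = false by apply/eqP; lia.
lia.
Qed.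

Lemma pot_drop bk bk' v k : v < n ->
  (forall z, z < n -> phi z (bk' z) <= phi z (bk z)) ->
  phi v (bk' v) + k <= phi v (bk v) -> pot bk' + k <= pot bk.
Proof.
move=> hv le_phi hk.
rewrite /pot (bigD1 (Ordinal hv)) //= [X in _ <= X](bigD1 (Ordinal hv)) //= addnAC.
by apply: leq_add => //; apply: leq_sum => i _; apply: le_phi.
Qed.

Definition kinv (key bk : nat -> nat) (last : nat) : Prop :=
  forall v, v < n -> (bk v = 0 -> key v <= last) /\
    (0 < bk v -> [/\ last <= key v, upp last (key v) (bk v)
                   & exa last (key v) (bk v)]).

Lemma W_gt1 : 1 < 2 ^ W. Proof. by lia. Qed.
Hint Resolve W_gt1 : core.

Lemma run_RELAX r m t key bk pm ps S v x last (Q : st -> Prop) :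
  env r -> rep m key bk pm ps S -> parr bk pm ps S -> kinv key bk last ->
  r 40 = v -> v < n -> r 41 = x -> r 20 = last -> last <= x < 2 ^ W ->
  (forall r' m' t' key' bk' pm' ps' S', (forall i, i < 50 -> r' i = r i) ->
     rep m' key' bk' pm' ps' S' -> parr bk' pm' ps' S' -> kinv key' bk' last ->
     (forall z, key' z = if (z == v) && (x < key v) then x else key z) ->
     (forall z, (bk' z == 0) = (bk z == 0)) ->
     t' + pot bk' <= t + pot bk + 20 -> Q (St r' m' t')) ->
  srun RELAX (St r m t) Q.
Proof.
move=> hE R H K E40 hv E41 E20 /andP[hlx hx] HQ.
have [E10 E11 E12 E13 [E14 E15 E16 E17 E18]] := hE.
sbin ev_add; sread; first by apply: (rep_key R).
sbin ev_lt => //; apply: run_if => //=.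
rewrite {1}/upd /=; case: ltnP => hlt /=; last first.
  apply: run_skip; rewrite /sbump /=.
  apply: (HQ _ _ _ key bk pm ps S) => //; [| |lia].
  - by move=> i hi; rewrite !(upd_far _ _ hi).
  - by move=> z; rewrite ltnNge hlt andbF.
rewrite /sbump /=; swrite.
have {}R := rep_upd_key n_gt0 kbob Sp_big Sp_word x R hv.
have [K0 K1] := K _ hv.
have b0 : 0 < bk v.
  by case: (posnP (bk v)) => // /K0 h; lia.
have [h1 h2 h3] := K1 b0.
apply: (run_SIFT input n_gt0 kbob Sp_big Sp_word (v := v) (x := x) (last := last) _ R H) => //; try lia.
  by apply: upp_between h2; lia.
move=> r' m' t' bk' pm' ps' S' Er R' H' Eb hb' hu he ht.
apply: (HQ _ _ _ _ _ _ _ _ _ R' H') => /=.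
- move=> i hi; rewrite Er; last by lia.
  by rewrite !(upd_far _ _ hi).
- move=> z hz; rewrite /upd; case: eqP => [->|zv]; last by rewrite Eb //; apply: K.
  by split=> [|_]; [lia | split].
- by move=> z; rewrite hlt andbT /upd.
- move=> z; case: (z =P v) => [->|/Eb -> //].
  by rewrite !eqn0Ngt b0; case/andP: hb' => ->.
- by have := pot_lower hv Eb hb'; lia.
Qed.

Definition closed (key : nat -> nat) (u : nat) : Prop :=
  forall z w : nat, (z, w) \in adj u -> key z <= key u + w.

Definition sound (key : nat -> nat) : Prop :=
  key s = 0 /\ forall v, v < n -> key v <= INF /\ (key v < INF -> dpath v (key v)).

Lemma run_EDGES r m t key bk pm ps S u last (l : seq (nat * nat)) (Q : st -> Prop) :
  env r -> rep m key bk pm ps S -> parr bk pm ps S -> kinv key bk last ->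
  sound key -> u < n -> bk u = 0 -> key u = last -> r 20 = last ->
  (forall v, v < n -> bk v = 0 -> v <> u -> closed key v) ->
  (forall z w : nat, (z, w) \in adj u -> key z <= last + w \/ (z, w) \in l) ->
  {subset l <= adj u} -> list_at W input (r 25) l ->
  (forall r' m' t' key' bk' pm' ps' S', (forall i, i < 21 -> r' i = r i) ->
     rep m' key' bk' pm' ps' S' -> parr bk' pm' ps' S' -> kinv key' bk' last ->
     sound key' -> (forall v, v < n -> bk' v = 0 -> closed key' v) ->
     t' + pot bk' <= t + pot bk + 30 * size l + 1 -> Q (St r' m' t')) ->
  srun EDGES (St r m t) Q.
Proof.
move=> hE R H K Hs hu bu ku E20 Hc Hl sl hl HQ.
pose I k (s : st) := exists key' bk' pm' ps' S' (l' : seq (nat * nat)),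
  [/\ [/\ rep (mm s) key' bk' pm' ps' S', parr bk' pm' ps' S', kinv key' bk' last
        & (forall i, i < 21 -> rg s i = r i)],
      [/\ sound key', bk' u = 0, key' u = last
        & forall v, v < n -> bk' v = 0 -> v <> u -> closed key' v],
      (forall z w : nat, (z, w) \in adj u -> key' z <= last + w \/ (z, w) \in l'),
      {subset l' <= adj u} /\ list_at W input (rg s 25) l'
    & k = size l' /\ tm s + pot bk' + 30 * size l' <= t + pot bk + 30 * size l].
apply: (run_while (I := I) _ _ _ (k := size l)) => //; last first.
  by exists key, bk, pm, ps, S, l; split.
- move=> k [r1 m1 t1] [key1 [bk1 [pm1 [ps1 [S1 [l1 [/= [R1 H1 K1 Er1] [Hs1 bu1 ku1 Hc1] Hl1 [sl1 hl1] [_ ht1]]]]]]]] E0.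
  rewrite /sbump /=; case: l1 Hl1 sl1 hl1 ht1 => [|[z w] l1] Hl1 sl1 /=; last first.
    by case=> h; rewrite E0 in h.
  move=> _ ht1; apply: (HQ _ _ _ _ _ _ _ _ Er1 R1 H1 K1 Hs1); last by lia.
  move=> v hv bv; case: (v =P u) => [->|vu]; last exact: Hc1.
  by move=> z w /Hl1[]; rewrite ku1.
move=> k [r1 m1 t1] [key1 [bk1 [pm1 [ps1 [S1 [l1 [/= [R1 H1 K1 Er1] [Hs1 bu1 ku1 Hc1] Hl1 [sl1 hl1] [-> ht1]]]]]]]] E0.
case: l1 Hl1 sl1 hl1 ht1 => [|[z w] l1] Hl1 sl1 /=; first by move=> h; case: E0.
case=> _ h2 h3 h4 h5 ht1.
have hE1 : env r1 by apply: env_eq hE => i hi; apply: Er1; lia.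
have [E10 E11 E12 E13 [E14 E15 E16 E17 E18]] := hE1.
have E20' : r1 20 = last by rewrite Er1.
have hin : (z, w) \in adj u by apply: sl1; rewrite inE eqxx.
have [hz hw] := adj_ok hu hin.
have hlast : last <= INF by rewrite -ku1; case: (proj2 Hs1 u hu).
rewrite /sbump /=.
sq; eapply r_input; [done | lk | exact: h3 | ].
sbin ev_add.
sq; eapply r_input; [done | lk | rewrite addn1; exact: h4 | ].
sbin ev_add.
sq; eapply r_input; [done | lk | reflexivity | ].
sbin ev_add.
apply: (run_RELAX (v := z) (x := last + w) (last := last) _ R1 H1 K1) => //=; try lia.
move=> r2 m2 t2 key2 bk2 pm2 ps2 S2 Er2 R2 H2 K2 Ek Eb ht2.
have eb0 v : bk2 v = 0 <-> bk1 v = 0.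
  by have := Eb v; split=> h; rewrite h eqxx in H0 *; apply/eqP.
have kle v : key2 v <= key1 v.
  by rewrite Ek; case: (v =P z) => //= ->; case: ifP => // /ltnW.
have ks v : v < n -> bk1 v = 0 -> key2 v = key1 v.
  move=> hv bv; rewrite Ek; case: (v =P z) => //= vz; case: ltnP => // hlt.
  by have [/(_ bv) h _] := K1 v hv; rewrite vz in h; lia.
exists (size l1) => //.
exists key2, bk2, pm2, ps2, S2, l1; split=> //=.
- split=> // i hi; rewrite Er2; last by lia.
  by rewrite -Er1 // /upd; do !(case: eqP => [?|_]; first by lia).
- split; last 1 first.
  + move=> v hv /eb0 bv vu z' w' hin'; rewrite (ks v) //.
    by apply: leq_trans (kle _) _; apply: Hc1.
  + have [k0 kd] := Hs1; split; first by have := kle s; rewrite k0 leqn0 => /eqP.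
    move=> v hv; have [h6 h7] := kd v hv; split; first exact: leq_trans (kle v) h6.
    rewrite Ek; case: (v =P z) => //= ->; case: (ltnP (last + w)) => [hlt hI|_]; last exact: (proj2 (kd z hz)).
    by apply: (dpathS _ hin); rewrite -ku1; apply: (proj2 (kd u hu)); rewrite ku1; lia.
  + exact/eb0.
  + by rewrite ks.
- move=> z' w' hin'; case: (Hl1 z' w' hin') => [h|].
    by left; apply: leq_trans (kle _) h.
  rewrite inE => /orP[/eqP[-> ->]|]; last by right.
  by left; rewrite Ek eqxx /=; case: ltnP => // /ltnW.
- split; first by move=> e he; apply: sl1; rewrite inE he orbT.
  rewrite Er2 //; move: h5; rewrite /upd /=.
  by have -> : (r1 25 + 1 + 1) = (r1 25).+2 by lia.
- by split=> //; rewrite /= in ht2; lia.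
Qed.

Lemma run_NONEMPTY r m t key bk pm ps S b (Q : st -> Prop) :
  env r -> rep m key bk pm ps S -> parr bk pm ps S -> r 23 = b -> b <= TOP ->
  (forall r', (forall i, i < 25 -> r' i = r i) -> r' 29 = r 29 ->
     r' 25 = S b -> r' 27 = (S b < S b.+1) -> Q (St r' m (t + 5))) ->
  srun NONEMPTY (St r m t) Q.
Proof.
move=> [E10 E11 E12 E13 [E14 E15 E16 E17 E18]] R H E23 hb HQ.
sbin ev_add; sread; first by apply: (rep_S R); lia.
sbin ev_add; sread; first by rewrite -addnA addn1; apply: (rep_S R).
sbin ev_lt => //.
rewrite -[X in St _ _ X](_ : t + 5 = _); last by lia.
by apply: HQ => // i hi; rewrite !(upd_far _ _ hi).
Qed.

Lemma S_range bk pm ps S b : parr bk pm ps S -> b <= TOP -> S b < S b.+1 ->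
  pm (S b) < n /\ bk (pm (S b)) = b.
Proof.
move=> H hb lt_S; have hn : S b < n by have := S_n H (b := b.+1); lia.
have [h1 h2] := pmK H hn; split=> //.
have e1 : b <= bk (pm (S b)) by rewrite -(S_le H) ?h2 //; lia.
have e2 : ~~ (b.+1 <= bk (pm (S b))) by rewrite -(S_le H) ?h2 //; lia.
lia.
Qed.

Lemma S_empty bk pm ps S b v : parr bk pm ps S -> b <= TOP ->
  ~~ (S b < S b.+1) -> v < n -> bk v <> b.
Proof.
move=> H hb lt_S hv E.
have e1 : S b <= ps v by rewrite (S_le H) ?E //; lia.
have e2 : ~~ (S b.+1 <= ps v) by rewrite (S_le H) ?E //; lia.
lia.
Qed.

Lemma run_REDIST r m t key bk pm ps S u b last (Q : st -> Prop) :
  env r -> rep m key bk pm ps S -> parr bk pm ps S -> kinv key bk last ->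
  (forall v, v < n -> key v <= INF) -> r 20 = last -> r 23 = b ->
  u < n -> bk u = b -> 1 < b -> (forall v, v < n -> bk v = 0 \/ b <= bk v) ->
  (forall r' m' t' bk' pm' ps' S' last', (forall i, i < 20 -> r' i = r i) ->
     rep m' key bk' pm' ps' S' -> parr bk' pm' ps' S' -> kinv key bk' last' ->
     (forall z, z < n -> (bk' z == 0) = (bk z == 0)) ->
     r' 20 = last' -> t' + pot bk' + 80 <= t + pot bk -> Q (St r' m' t')) ->
  srun REDIST (St r m t) Q.
Proof.
move=> hE R H K hI E20 E23 hu bu b1 hmin HQ.
have hb : b <= TOP by rewrite -bu; apply: (bk_le H).
have [E10 E11 E12 E13 [E14 E15 E16 E17 E18]] := hE.
have [hul hup hue] : [/\ last <= key u, upp last (key u) b & exa last (key u) b].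
  by have [_] := K u hu; rewrite bu; apply; lia.
have keyu := hI u hu.
have [ll' l'u movu uppl'] := jumpP b1 hul hup hue.
pose last' := jump last b; rewrite -/last' in ll' l'u movu uppl'.
have hl' : last' < 2 ^ W by lia.
have hq : last %/ 2 ^ (b - 2) + 1 <= last'.
  by rewrite /last' /jump leq_pmulr // expn_gt0.
have K' : forall v, v < n -> (bk v = 0 -> key v <= last') /\
    (0 < bk v -> [/\ last' <= key v, upp last' (key v) (bk v)
              & exa last' (key v) (bk v) \/ bk v = b]).
  move=> v hv; have [k0 k1] := K v hv; split; first by move/k0; lia.
  move=> bv; have [k2 k3 k4] := k1 bv.
  have [|lt_b|E] := ltngtP b (bk v); last 1 first.
  - rewrite -E in k3 k4; have [h1 h2 h3 h4] := jumpP b1 k2 k3 k4.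
    rewrite -E; split=> //; last by right.
    by apply: (upp_up _ (proj2 (mov_upp h3))); lia.
  - by move=> lt_b; have [h1 h2 h3] := jump_above b1 lt_b k2 uppl' k3 k4; split=> //; left.
  - by case: (hmin v hv); lia.
have Kb v : v < n -> bk v = b -> mov last' (key v) b.
  move=> hv bv; have [_ k1] := K v hv; have [|k2 k3 k4] := k1; first by lia.
  by rewrite bv in k3 k4; case: (jumpP b1 k2 k3 k4).
sbin ev_sub; sbin ev_sub.
have -> : b - 1 - 1 = b - 2 by lia.
sbin ev_shr; sbin ev_add.
sbin ev_shl; first exact: hl'.
rewrite -/(jump last b) -/last'; clear hq.
apply: run_seq; apply: (run_NONEMPTY (b := b) _ R H) => //.
move=> r1 Er1 Er29 Er25 Er27.
pose I k (s : st) := exists bk' pm' ps' S',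
  [/\ [/\ rep (mm s) key bk' pm' ps' S', parr bk' pm' ps' S'
        & (forall i, i < 20 -> rg s i = r i)],
      [/\ rg s 20 = last', rg s 23 = b, rg s 25 = S' b
        & rg s 27 = (S' b < S' b.+1)],
      (forall z, (bk' z == 0) = (bk z == 0)),
      (forall v, v < n -> (bk' v = 0 -> key v <= last') /\
        (0 < bk' v -> [/\ last' <= key v, upp last' (key v) (bk' v)
           & bk' v = bk v \/ exa last' (key v) (bk' v) /\ bk' v < b]))
    & k = pot bk' /\ 2 * tm s + pot bk' <= 2 * t + pot bk + 20].
apply: (run_while (I := I) _ _ _ (k := pot bk)) => //; last first.
- exists bk, pm, ps, S; split=> //=.
  + split=> // i hi; rewrite Er1; last by lia.
    by rewrite !(upd_far _ _ hi).
  + by split=> //; rewrite Er1.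
  + move=> v hv; have [k0 k1] := K' v hv; split=> // /k1[h1 h2 _]; split=> //.
    by left.
  + by split=> //; lia.
- move=> k [r2 m2 t2] [bk2 [pm2 [ps2 [S2 [/= [R2 H2 Er2] [E20' E23' E25 E27] Eb K2 [_ ht2]]]]]] E0.
  have emp : ~~ (S2 b < S2 b.+1) by move: E0; rewrite E27; case: (_ < _).
  have ne v : v < n -> bk2 v <> b by move=> hv; apply: S_empty H2 hb emp hv.
  have hb2 : 0 < bk2 u < b.
    have b0 : 0 < bk2 u by rewrite lt0n Eb bu; lia.
    by have [_ k1] := K2 u hu; case: (k1 b0) => _ _ [|[]]; have := ne u hu; lia.
  rewrite /sbump /=; apply: (HQ _ _ _ _ _ _ _ last' Er2 R2 H2) => //.
  + move=> v hv; have [k0 k1] := K2 v hv; split=> // b0.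
    have [h1 h2 [h3|[]//]] := k1 b0; split=> //; rewrite h3.
    have [_ k2] := K' v hv; case: k2 => [|_ _ []//]; first by rewrite -h3.
    by move=> h; case: (ne v hv); rewrite h3.
  + suff : pot bk2 + 200 <= pot bk by lia.
    have le_phi v : v < n -> phi v (bk2 v) <= phi v (bk v).
      move=> hv; rewrite /phi Eb leq_add2r leq_mul2l /=.
      have := Eb v; case: (posnP (bk2 v)) => [-> //|b0 _].
      have [_ k1] := K2 v hv; case: (k1 b0) => _ _ [-> //|[_ lt_b]].
      by case: (hmin v hv) => [h|]; [have := Eb v; rewrite h; lia | lia].
    by apply: (pot_drop hu le_phi); rewrite /phi Eb bu; lia.
move=> k [r2 m2 t2] [bk2 [pm2 [ps2 [S2 [/= [R2 H2 Er2] [E20' E23' E25 E27] Eb K2 [-> ht2]]]]]] E0.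
have hE2 : env r2 by apply: env_eq hE => i hi; apply: Er2; lia.
have [F10 F11 F12 F13 [F14 F15 F16 F17 F18]] := hE2.
have lt_S : S2 b < S2 b.+1 by move: E0; rewrite E27; case: (_ < _).
have [] := S_range H2 hb lt_S; set v := pm2 (S2 b) => hv bv.
have hSn : S2 b < n by have := S_n H2 (b := b.+1); lia.
have keyv := hI v hv.
have [_ k1] := K2 v hv; have [|k2 k3 k4] := k1; first by lia.
rewrite bv in k3 k4.
have mv : mov last' (key v) b by apply: Kb => //; case: k4 => [//|]; lia.
rewrite /sbump /=.
sbin ev_add; sread; first by apply: (rep_pm R2).
rewrite -/v; sbin ev_add; sread; first by apply: (rep_key R2).
apply: run_seq.
apply: (run_SIFT input n_gt0 kbob Sp_big Sp_word (v := v) (x := key v) (last := last') _ R2 H2) => //=; try lia.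
  by rewrite bv.
move=> r3 m3 t3 bk3 pm3 ps3 S3 Er3 R3 H3 Eb3 hb3 hu3 he3 ht3.
have Er3' i : i < 25 -> r3 i = r2 i.
  move=> hi; rewrite Er3; last by lia.
  by rewrite !(upd_far _ _ hi).
have hE3 : env r3 by apply: env_eq hE2 => i hi; apply: Er3'; lia.
apply: (run_NONEMPTY (b := b) hE3 R3 H3) => //; first by rewrite Er3'.
move=> r4 Er4 Er29' Er25' Er27'.
have lt_b3 : bk3 v < b.
  rewrite ltn_neqAle; apply/andP; split; last by lia.
  by apply/eqP => h; move: he3; rewrite h /exa mv.
have hpot := pot_lower hv Eb3 hb3.
exists (pot bk3); first by lia.
exists bk3, pm3, ps3, S3; split=> //=.
- split=> // i hi; rewrite Er4; last by lia.
  by rewrite Er3' ?Er2 //; lia.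
- by split=> //; rewrite Er4 // Er3'.
- move=> z; case: (z =P v) => [->|/Eb3 -> //].
  by rewrite -Eb !eqn0Ngt bv; case/andP: hb3 => -> _; lia.
- move=> z hz; case: (z =P v) => [->|zv]; last by rewrite Eb3 //; apply: K2.
  split; first by lia.
  by move=> _; split=> //; right.
- by split=> //; lia.
Qed.
Lemma run_SETTLE r m t key bk pm ps S u last (Q : st -> Prop) :
  env r -> rep m key bk pm ps S -> parr bk pm ps S -> kinv key bk last ->
  sound key -> (forall v, v < n -> bk v = 0 -> closed key v) ->
  r 20 = last -> r 22 = u -> u < n -> bk u = 1 ->
  (forall r' m' t' key' bk' pm' ps' S', (forall i, i < 21 -> r' i = r i) ->
     rep m' key' bk' pm' ps' S' -> parr bk' pm' ps' S' -> kinv key' bk' last ->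
     sound key' -> (forall v, v < n -> bk' v = 0 -> closed key' v) ->
     t' + pot bk' + 80 <= t + pot bk -> Q (St r' m' t')) ->
  srun SETTLE (St r m t) Q.
Proof.
move=> hE R H K Hs Hc E20 E22 hu bu HQ.
have ku : key u = last.
  have [_ k1] := K u hu; case: k1; rewrite bu // => _.
  by rewrite /upp /= expn0 !divn1.
sq; eapply r_move; [done | lk | ].
apply: run_seq; apply: (run_MD input (INF := INF) n_gt0 kbob Sp_big Sp_word (v := u) _ R H) => //.
  by rewrite bu.
move=> r1 m1 bk1 pm1 ps1 S1 Er1 R1 H1 Eb1.
have hE1 : env r1 by apply: env_eq hE => i hi; rewrite Er1 ?(upd_far _ _ hi) //; lia.
have [E10 E11 E12 E13 [E14 E15 E16 E17 E18]] := hE1.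
have E22' : r1 22 = u by rewrite Er1.
have bu1 : bk1 u = 0 by rewrite Eb1 /upd eqxx bu.
have bo1 v : v <> u -> bk1 v = bk v by move=> h; rewrite Eb1 /upd; case: eqP.
sbin ev_add; sbin ev_add; sbin ev_add.
sq; eapply r_input; [done | lk | reflexivity | ].
have hpot := pot_upd1 hu bo1; rewrite bu bu1 {1}/phi {1}/phi /= in hpot.
apply: (run_EDGES (u := u) (last := last) (l := adj u) _ R1 H1) => //.
- move=> v hv; case: (v =P u) => [->|vu]; first by rewrite bu1 ku.
  by rewrite (bo1 v vu); apply: K.
- by rewrite /upd /= Er1.
- by move=> v hv bv vu; apply: Hc => //; rewrite -bo1.
- by move=> z w; right.
- by rewrite /upd /=; apply: adj_list.
move=> r2 m2 t2 key2 bk2 pm2 ps2 S2 Er2 R2 H2 K2 Hs2 Hc2 ht2.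
apply: (HQ _ _ _ _ _ _ _ _ _ R2 H2 K2 Hs2 Hc2); last by lia.
move=> i hi; rewrite Er2 // !(upd_far _ _ hi) // Er1; last by lia.
by rewrite (upd_far _ _ hi).
Qed.

Lemma run_HEADK r m t key bk pm ps S (Q : st -> Prop) :
  env r -> rep m key bk pm ps S ->
  (forall r', (forall i, i < 21 -> r' i = r i) ->
     r' 21 = S 1 -> r' 24 = (S 1 < n) -> Q (St r' m (t + 3))) ->
  srun HEADK (St r m t) Q.
Proof.
move=> [E10 E11 E12 E13 [E14 E15 E16 E17 E18]] R HQ.
sbin ev_add; sread; first by apply: (rep_S R); lia.
sbin ev_lt => //.
rewrite -[X in St _ _ X](_ : t + 3 = _); last by lia.
by apply: HQ => // i hi; rewrite !(upd_far _ _ hi).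
Qed.

Lemma run_DIJK r m t key bk pm ps S last (Q : st -> Prop) :
  env r -> rep m key bk pm ps S -> parr bk pm ps S -> kinv key bk last ->
  sound key -> (forall v, v < n -> bk v = 0 -> closed key v) -> r 20 = last ->
  (forall r' m' t' key' bk' pm' ps' S', (forall i, i < 20 -> r' i = r i) ->
     rep m' key' bk' pm' ps' S' -> sound key' ->
     (forall v, v < n -> closed key' v) ->
     t' <= t + pot bk + 4 -> Q (St r' m' t')) ->
  srun DIJK (St r m t) Q.
Proof.
move=> hE R H K Hs Hc E20 HQ.
apply: run_seq; apply: (run_HEADK hE R) => r0 Er0 E21 E24.
pose I k (s : st) := exists key' bk' pm' ps' S' last',
  [/\ [/\ rep (mm s) key' bk' pm' ps' S', parr bk' pm' ps' S', kinv key' bk' last'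
        & (forall i, i < 20 -> rg s i = r i)],
      [/\ rg s 20 = last', rg s 21 = S' 1 & rg s 24 = (S' 1 < n)],
      sound key', (forall v, v < n -> bk' v = 0 -> closed key' v)
    & k = pot bk' /\ tm s + pot bk' <= t + pot bk + 3].
apply: (run_while (I := I) _ _ _ (k := pot bk)) => //; last first.
- exists key, bk, pm, ps, S, last; split=> //=.
  + by split=> // i hi; rewrite Er0 //; lia.
  + by split=> //; rewrite Er0.
  + by split=> //; lia.
- move=> k [r1 m1 t1] [key1 [bk1 [pm1 [ps1 [S1 [last1 [/= [R1 H1 K1 Er1] [F20 F21 F24] Hs1 Hc1 [_ ht1]]]]]]]] E0.
  rewrite /sbump /=; apply: (HQ _ _ _ _ _ _ _ _ Er1 R1 Hs1); last by lia.
  move=> v hv; apply: Hc1 => //; case: (posnP (bk1 v)) => // b0.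
  have h1 : S1 1 <= ps1 v by rewrite (S_le H1).
  have [h2 _] := psK H1 hv.
  by move: F24; rewrite E0; case: ltnP => //; lia.
move=> k [r1 m1 t1] [key1 [bk1 [pm1 [ps1 [S1 [last1 [/= [R1 H1 K1 Er1] [F20 F21 F24] Hs1 Hc1 [-> ht1]]]]]]]] E0.
have hE1 : env r1 by apply: env_eq hE => i hi; apply: Er1; lia.
have [E10 E11 E12 E13 [E14 E15 E16 E17 E18]] := hE1.
have lt_S : S1 1 < n by move: E0; rewrite F24; case: (_ < _).
have [hu pu] := pmK H1 lt_S; set u := pm1 (S1 1) in hu pu.
have bu0 : 0 < bk1 u by rewrite -(S_le H1) ?pu.
have bule := bk_le H1 hu.
have hmin v : v < n -> bk1 v = 0 \/ bk1 u <= bk1 v.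
  move=> hv; case: (posnP (bk1 v)) => b0; [by left | right].
  have h1 : S1 1 <= ps1 v by rewrite (S_le H1).
  have h2 : S1 (bk1 u) <= ps1 u by rewrite (S_le H1) //; lia.
  by rewrite -(S_le H1) //; [rewrite pu in h2; lia | lia].
pose mid (s' : st) := exists key' bk' pm' ps' S' last',
  [/\ [/\ rep (mm s') key' bk' pm' ps' S', parr bk' pm' ps' S', kinv key' bk' last'
        & (forall i, i < 20 -> rg s' i = r i)],
      rg s' 20 = last', sound key', (forall v, v < n -> bk' v = 0 -> closed key' v)
    & tm s' + pot bk' + 70 <= t1 + pot bk1].
rewrite /sbump /=.
sbin ev_add; sread; first by apply: (rep_pm R1).
rewrite -/u; sbin ev_add; sread; first by apply: (rep_bk R1).
sbin ev_lt => //.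
apply: run_seq; apply: srun_tm; apply: (@run_conseq _ _ _ _ _ _ _ _ mid).
  apply: run_if => //; rewrite /sbump /= {1}/upd /=.
  case: ltnP => hb /=.
    apply: (run_REDIST (u := u) (b := bk1 u) (last := last1) _ R1 H1 K1) => //.
      by move=> v hv; case: (proj2 Hs1 v hv).
    move=> r2 m2 t2 bk2 pm2 ps2 S2 last2 Er2 R2 H2 K2 Eb2 G20 ht2.
    exists key1, bk2, pm2, ps2, S2, last2; split=> //=.
    + split=> // i hi; rewrite Er2 // !(upd_far _ _ hi) //; exact: Er1.
    + by move=> v hv bv; apply: Hc1 => //; apply/eqP; rewrite -Eb2 // bv.
    + by lia.
  have bu1 : bk1 u = 1 by lia.
  apply: (run_SETTLE (u := u) (last := last1) _ R1 H1 K1) => //.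
  move=> r2 m2 t2 key2 bk2 pm2 ps2 S2 Er2 R2 H2 K2 Hs2 Hc2 ht2.
  exists key2, bk2, pm2, ps2, S2, last1; split=> //=.
  + split=> // i hi; rewrite Er2; last by lia.
    by rewrite !(upd_far _ _ hi) //; apply: Er1.
  + by rewrite Er2.
  + by lia.
move=> [r2 m2 t2] [key2 [bk2 [pm2 [ps2 [S2 [last2 [/= [R2 H2 K2 Er2] G20 Hs2 Hc2 ht2]]]]]]] /= ht2'.
have hE2 : env r2 by apply: env_eq hE => i hi; apply: Er2; lia.
apply: (run_HEADK hE2 R2) => r3 Er3 G21 G24.
exists (pot bk2); first by lia.
exists key2, bk2, pm2, ps2, S2, last2; split=> //=.
- by split=> // i hi; rewrite Er3 ?Er2 //; lia.
- by split=> //; rewrite Er3.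
- by split=> //; lia.
Qed.

Definition INIT : cmd :=
  Bin OpSub 31 10 10 ;; Bin OpLt 24 31 11 ;;
  While 24 (Bin OpAdd 28 13 31 ;; Write 28 12 ;; Bin OpAdd 28 14 31 ;;
            Write 28 18 ;; Bin OpAdd 28 15 31 ;; Write 28 31 ;;
            Bin OpAdd 28 16 31 ;; Write 28 31 ;; Bin OpAdd 31 31 10 ;;
            Bin OpLt 24 31 11) ;;
  Bin OpSub 31 10 10 ;; Bin OpSub 20 10 10 ;; Bin OpAdd 29 18 10 ;;
  Bin OpLt 24 31 29 ;;
  While 24 (Bin OpAdd 28 17 31 ;; Write 28 20 ;; Bin OpAdd 31 31 10 ;;
            Bin OpLt 24 31 29) ;;
  Bin OpAdd 28 17 29 ;; Write 28 11.

Lemma run_INIT r m t (Q : st -> Prop) :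
  env r ->
  (forall r' m' t', (forall i, i < 20 -> r' i = r i) -> r' 20 = 0 ->
     rep m' (fun=> INF) (fun=> TOP) id id (fun b => if b <= TOP then 0 else n) ->
     t' <= t + 12 * n + 6 * TOP + 20 -> Q (St r' m' t')) ->
  srun INIT (St r m t) Q.
Proof.
move=> hE HQ.
have [E10 E11 E12 E13 [E14 E15 E16 E17 E18]] := hE.
sbin ev_sub; sbin ev_lt => //.
pose I k (s : st) := exists i,
  [/\ i <= n /\ rg s 31 = i, rg s 24 = (i < n), (forall j, j < 20 -> rg s j = r j),
      (forall j, j < i -> [/\ mm s (kb + j) = INF, mm s (2 * n + j) = TOP,
         mm s (3 * n + j) = j & mm s (4 * n + j) = j])
    & k = n - i /\ tm s <= t + 12 * i + 2].
apply: run_seq; apply: (run_while (I := I) _ _ _ (k := n)) => //; last first.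
- exists 0; split=> //=.
  + by move=> i hi; rewrite !(upd_far _ _ hi).
  + by split; lia.
- move=> k [r1 m1 t1] [i [/= [hi F31] F24 Er1 A1 [_ ht1]]] E0.
  have {hi} ni : i = n by move: F24; rewrite E0; case: ltnP => //; lia.
  rewrite {}ni in F31 F24 A1 ht1; clear i; rewrite /sbump /=.
  have hE1 : env r1 by apply: env_eq hE.
  have [G10 G11 G12 G13 [G14 G15 G16 G17 G18]] := hE1.
  sbin ev_sub; sbin ev_sub; sbin ev_add; sbin ev_lt => //.
  pose J k (s : st) := exists i,
    [/\ i <= TOP.+1 /\ rg s 31 = i, rg s 24 = (i < TOP.+1) /\ rg s 29 = TOP.+1,
        (forall j, j < 20 -> rg s j = r j) /\ rg s 20 = 0,
        (forall j, j < n -> [/\ mm s (kb + j) = INF, mm s (2 * n + j) = TOP,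
           mm s (3 * n + j) = j & mm s (4 * n + j) = j]) /\
        (forall b, b < i -> mm s (5 * n + b) = 0)
      & k = TOP.+1 - i /\ tm s <= t + 12 * n + 6 * i + 7].
  apply: run_seq; apply: (run_while (I := J) _ _ _ (k := TOP.+1)) => //; last first.
  + exists 0; split=> //=.
    * by rewrite /upd /= addn1.
    * by split=> // j hj; rewrite !(upd_far _ _ hj) //; apply: Er1.
    * by split; lia.
  + move=> k' [r2 m2 t2] [i [/= [hi H31] [H24 H29] [Er2 H20] [A2 B2] [_ ht2]]] E0'.
    have {hi} ni : i = TOP.+1 by move: H24; rewrite E0'; case: ltnP => //; lia.
    rewrite {}ni in H31 H24 B2 ht2; clear i; rewrite /sbump /=.
    have hE2 : env r2 by apply: env_eq hE.
    have [J10 J11 J12 J13 [J14 J15 J16 J17 J18]] := hE2.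
    sbin ev_add; swrite.
    apply: HQ => //; last by lia.
      by move=> j hj; rewrite (upd_far _ _ hj) //; apply: Er2.
    split=> [j hj|j hj|j hj|j hj|b hb]; rewrite /upd; case: eqP => h; try (exfalso; lia).
    * by case: (A2 j hj).
    * by case: (A2 j hj).
    * by case: (A2 j hj).
    * by case: (A2 j hj).
    * by case: leqP => //; lia.
    * by have hb' : b < TOP.+1; [lia | rewrite -ltnS hb'; apply: B2].
  + move=> k' [r2 m2 t2] [i [/= [hi H31] [H24 H29] [Er2 H20] [A2 B2] [-> ht2]]] E0'.
    have {}hi : i < TOP.+1 by move: E0'; rewrite H24; case: (_ < _).
    have hE2 : env r2 by apply: env_eq hE.
    have [J10 J11 J12 J13 [J14 J15 J16 J17 J18]] := hE2.
    rewrite /sbump /=.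
    sbin ev_add; swrite; sbin ev_add; sbin ev_lt => //.
    exists (TOP.+1 - i.+1); first by lia.
    exists i.+1; split=> //=.
    * by rewrite /upd /= addn1.
    * by rewrite /upd /= addn1.
    * by split=> // j hj; rewrite !(upd_far _ _ hj) //; apply: Er2.
    * split=> [j hj|b hb].
        by have [h1 h2 h3 h4] := A2 j hj; split; rewrite /upd; case: eqP => // h; exfalso; lia.
      by rewrite /upd; case: eqP => // h; apply: B2; lia.
    * by split=> //; lia.
- move=> k [r1 m1 t1] [i [/= [hi F31] F24 Er1 A1 [-> ht1]]] E0.
  have {}hi : i < n by move: E0; rewrite F24; case: (_ < _).
  have hE1 : env r1 by apply: env_eq hE.
  have [G10 G11 G12 G13 [G14 G15 G16 G17 G18]] := hE1.
  rewrite /sbump /=.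
  sbin ev_add; swrite; sbin ev_add; swrite; sbin ev_add; swrite; sbin ev_add; swrite.
  sbin ev_add; sbin ev_lt => //.
  exists (n - i.+1); first by lia.
  exists i.+1; split=> //=.
  + by rewrite /upd /= addn1.
  + by rewrite /upd /= addn1.
  + by move=> j hj; rewrite !(upd_far _ _ hj) //; apply: Er1.
  + move=> j hj; case: (j =P i) => [->|ji].
      by split; rewrite /upd; do !(case: eqP => [h|_] //; try (exfalso; lia)); lia.
    have [|h1 h2 h3 h4] := A1 j; first by lia.
    by split; rewrite /upd; do !(case: eqP => [h|_]; first by exfalso; lia).
  + by split=> //; lia.
Qed.

Definition SSSP : cmd := INIT ;; Move 40 19 ;; Move 41 20 ;; RELAX ;; DIJK.

Lemma run_SSSP r m t (Q : st -> Prop) :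
  env r -> r 19 = s ->
  (forall r' m' t', (forall i, i < 20 -> r' i = r i) ->
     (forall v, v < n -> [/\ m' (kb + v) <= INF,
        m' (kb + v) < INF -> dpath v (m' (kb + v))
        & forall d, dpath v d -> m' (kb + v) <= d]) ->
     t' <= t + 12 * n + 6 * TOP + 50 + n * (200 * TOP)
           + 100 * \sum_(v < n) size (adj v) -> Q (St r' m' t')) ->
  srun SSSP (St r m t) Q.
Proof.
move=> hE E19 HQ.
apply: run_seq; apply: (@run_INIT _ _ _ _ hE) => r1 m1 t1 Er1 E20 R1 ht1.
have E19' : r1 19 = s by rewrite Er1.
sq; eapply r_move; [done | lk | ].
sq; eapply r_move; [done | lk | ].
have hE1 : env r1 by apply: env_eq hE.
have I0 : 0 < INF by rewrite INF_def expn_gt0.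
have H1 : parr (fun=> TOP) id id (fun b => if b <= TOP then 0 else n).
  by split=> // [b hb|v b hv hb] /=; case: (leqP b TOP) => h; rewrite ?leq0n ?leqnn //; lia.
have K1 : kinv (fun=> INF) (fun=> TOP) 0.
  move=> v hv; split=> [h|_]; first by lia.
  split=> //.
    rewrite /upp INF_def !div0n divn_small // ltn_exp2l //; lia.
  rewrite /exa /mov TOP_gt1 /= INF_def div0n divnn expn_gt0 //.
apply: run_seq; apply: (run_RELAX (v := s) (x := 0) (last := 0) _ R1 H1 K1) => //.
  by rewrite expn_gt0.
move=> r2 m2 t2 key2 bk2 pm2 ps2 S2 Er2 R2 H2 K2 Ek2 Eb2 ht2.
have Er2' i : i < 20 -> r2 i = r i.
  move=> hi; rewrite Er2; last by lia.
  by rewrite !(upd_far _ _ hi) //; apply: Er1.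
have hE2 : env r2 by apply: env_eq hE.
have G20 : r2 20 = 0 by rewrite Er2.
have hs2 : sound key2.
  split=> [|v hv]; rewrite Ek2 I0 ?andbT ?eqxx //.
  by case: eqP => [->|_]; split=> //; [move=> _; apply: dpath0 | rewrite ltnn].
apply: (run_DIJK hE2 R2 H2 K2 hs2 _ G20).
  move=> v hv /eqP; rewrite Eb2 => /eqP; lia.
move=> r3 m3 t3 key3 bk3 pm3 ps3 S3 Er3 R3 [k0 hs3] Hc3 ht3.
apply: HQ.
- by move=> i hi; rewrite Er3 // Er2'.
- move=> v hv; rewrite (rep_key R3) //; have [h1 h2] := hs3 v hv; split=> // d hd.
  have [] : v < n /\ key3 v <= d; last by [].
  elim: hd => [|u e z w _ [hu le_d] hin]; first by rewrite k0.
  have [hz _] := adj_ok hu hin; split=> //.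
  by apply: leq_trans (Hc3 u hu z w hin) _; rewrite leq_add2r.
- suff : pot (fun=> TOP) = n * (200 * TOP) + 100 * \sum_(v < n) size (adj v).
    by rewrite /= in ht1 ht2; lia.
  rewrite /pot /phi big_split /= sum_nat_const card_ord big_distrr /=.
  by congr (_ + _); apply: eq_bigr => i _; case: eqP => //; lia.
Qed.

End Dijkstra.

(** * The average degree *)

Definition DEGSUM (K : nat) : cmd :=
  Bin OpSub 31 10 10 ;; Bin OpSub 32 10 10 ;; Bin OpLt 24 31 11 ;;
  While 24 (Bin OpAdd 28 31 31 ;; Bin OpAdd 28 28 10 ;; Input 28 28 ;;
            Bin OpAdd 32 32 28 ;; Bin OpAdd 31 31 10 ;; Bin OpLt 24 31 11) ;;
  Bin OpDiv 32 32 11 ;; Bin OpAdd 32 32 35 ;; Bin OpAdd 32 32 10 ;;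
  Const 33 K ;; Bin OpMul 32 32 33.

Lemma run_DEGSUM W input Sp ob n K L1 r m t (Q : st -> Prop) :
  0 < n -> n * n + n + n + L1 + 2 < 2 ^ W -> K < 2 ^ W ->
  K * (n + L1 + 1) < 2 ^ W ->
  (forall i, i < n -> input (i + i + 1) <= n) ->
  r 10 = 1 -> r 11 = n -> r 35 = L1 ->
  (forall r' t', (forall i, i < 20 -> r' i = r i) ->
     r' 32 = K * ((\sum_(i < n) input (i + i + 1)) %/ n + L1 + 1) ->
     t' <= t + 8 * n + 12 -> Q (St r' m t')) ->
  srun W input Sp ob n (DEGSUM K) (St r m t) Q.
Proof.
move=> n0 hW hK hT hdeg E10 E11 E35 HQ.
have W1 : 1 < 2 ^ W by lia.
pose d i := \sum_(j < i) input (j + j + 1).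
have hd i : i <= n -> d i <= i * n.
  move=> hi; rewrite /d; apply: leq_trans (_ : \sum_(j < i) n <= _).
    by apply: leq_sum => j _; apply: hdeg; apply: leq_trans hi.
  by rewrite sum_nat_const card_ord.
sbin ev_sub; sbin ev_sub; sbin ev_lt => //.
pose I k (s : st) := exists i,
  [/\ [/\ i <= n, rg s 31 = i, rg s 32 = d i & rg s 24 = (i < n)],
      (forall j, j < 20 -> rg s j = r j), rg s 35 = L1, mm s = m
    & k = n - i /\ tm s <= t + 8 * i + 3].
apply: run_seq; apply: (run_while (I := I) _ _ _ (k := n)) => //; last first.
- exists 0; split=> //=; last by split; lia.
    by split=> //; rewrite /d big_ord0.
  by move=> j hj; rewrite !(upd_far _ _ hj).
- move=> k [r1 m1 t1] [i [/= [hi F31 F32 F24] Er1 F35 -> [_ ht1]]] E0.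
  have {hi} ni : i = n by move: F24; rewrite E0; case: ltnP => //; lia.
  rewrite {}ni in F31 F32 F24 ht1; clear i; rewrite /sbump /=.
  have F10 : r1 10 = 1 by rewrite Er1.
  have F11 : r1 11 = n by rewrite Er1.
  have hdn := hd n (leqnn n).
  have hq : d n %/ n <= n by rewrite -(leq_pmul2r n0); apply: leq_trans (leq_trunc_div _ _) hdn.
  have [q Eq] : exists q, q = d n %/ n by exists (d n %/ n).
  sbin ev_div; rewrite -Eq in hq *.
  sbin ev_add; sbin ev_add.
  sq; eapply r_const; [done | reflexivity | done | ].
  have hm : (q + L1 + 1) * K <= K * (n + L1 + 1).
    by rewrite mulnC leq_mul2l !leq_add2r hq orbT.
  sbin ev_mul.
  apply: HQ; last by lia.
    by move=> j hj; rewrite !(upd_far _ _ hj) //; apply: Er1.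
  by rewrite /upd /= Eq mulnC.
- move=> k [r1 m1 t1] [i [/= [hi F31 F32 F24] Er1 F35 -> [-> ht1]]] E0.
  have {}hi : i < n by move: E0; rewrite F24; case: (_ < _).
  have F10 : r1 10 = 1 by rewrite Er1.
  have F11 : r1 11 = n by rewrite Er1.
  have h1 := hd i (ltnW hi); have h2 := hdeg i hi.
  have h3 : i * n <= n * n by rewrite leq_mul2r (ltnW hi) orbT.
  rewrite /sbump /=.
  sbin ev_add; sbin ev_add.
  sq; eapply r_input; [done | lk | reflexivity | ].
  sbin ev_add; sbin ev_add; sbin ev_lt => //.
  exists (n - i.+1); first by lia.
  exists i.+1; split=> //=.
    by split; rewrite /upd /= ?(addn1 i) //; rewrite /d big_ord_recr.
  + by move=> j hj; rewrite !(upd_far _ _ hj) //; apply: Er1.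
  + by split=> //; lia.
Qed.

(** * Paced enumeration of pending outputs *)

(* Registers: 0 the ticks until the next output; 1 the number of pending
   outputs; 2 the index of the next one; 5 the period; 6 the current row; 7 the
   base address of its distances; 8 nonzero in diagonal mode. *)
Definition EMIT : cmd :=
  If 8 (Bin OpSub 3 10 10 ;; Emit 2 2 3)
       (Bin OpAdd 3 6 2 ;; Bin OpMod 3 3 11 ;; Bin OpAdd 4 7 3 ;; Read 4 4 ;;
        Bin OpLt 9 4 12 ;; If 9 (Emit 6 3 4) (EmitInf 6 3)) ;;
  Bin OpAdd 2 2 10 ;; Bin OpSub 1 1 10.

Definition TICK : cmd :=
  Bin OpSub 0 0 10 ;; If 0 Skip (Move 0 5 ;; If 1 EMIT Skip).

Fixpoint tk (c : cmd) : cmd :=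
  match c with
  | Skip => Skip
  | Ins i => TICK ;; Ins i
  | Seq c1 c2 => tk c1 ;; tk c2
  | If r c1 c2 => If r (TICK ;; tk c1 ;; TICK) (TICK ;; tk c2 ;; TICK)
  | While r c => While r (TICK ;; tk c ;; TICK) ;; TICK
  end.

Section Low.

Variables (W : nat) (input : nat -> nat).
Notation lrun := (lrun W input).

Lemma l_bin o d a b x y v pc r m t u os (Q : config -> Prop) :
  r a = x -> r b = y -> eval_binop W o x y = v ->
  Q (Config pc (upd r d v) m t.+1 u os) ->
  lrun (Bin o d a b) (Config pc r m t u os) Q.
Proof. by move=> <- <- <- q; apply: run_ins. Qed.

Lemma l_const d k v pc r m t u os (Q : config -> Prop) :
  k = v -> v < 2 ^ W -> Q (Config pc (upd r d v) m t.+1 u os) ->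
  lrun (Const d k) (Config pc r m t u os) Q.
Proof. by move=> -> hv q; apply: run_ins => //=; rewrite modn_small. Qed.

Lemma l_move d a v pc r m t u os (Q : config -> Prop) :
  r a = v -> Q (Config pc (upd r d v) m t.+1 u os) ->
  lrun (Move d a) (Config pc r m t u os) Q.
Proof. by move=> <- q; apply: run_ins. Qed.

Lemma l_input d a x v pc r m t u os (Q : config -> Prop) :
  r a = x -> input x = v -> Q (Config pc (upd r d v) m t.+1 u os) ->
  lrun (Input d a) (Config pc r m t u os) Q.
Proof. by move=> <- <- q; apply: run_ins. Qed.

Lemma l_read d a x pc r m t u os (Q : config -> Prop) :
  r a = x -> Q (Config pc (upd r d (m x)) m t.+1 (maxn u x.+1) os) ->
  lrun (Read d a) (Config pc r m t u os) Q.
Proof. by move=> <- q; apply: run_ins. Qed.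

Lemma l_write a b x y pc r m t u os (Q : config -> Prop) :
  r a = x -> r b = y -> Q (Config pc r (upd m x y) t.+1 (maxn u x.+1) os) ->
  lrun (Write a b) (Config pc r m t u os) Q.
Proof. by move=> <- <- q; apply: run_ins. Qed.

End Low.

Ltac lbin L := sq; eapply l_bin; [lk | lk | apply: L; try lia | ].
Ltac lmove := sq; eapply l_move; [lk | ].

Definition val_of (INF d : nat) : option nat := if d < INF then Some d else None.

(* The [i]-th pending output [f i], in diagonal mode or in the row of vertex
   [r 6], which lists the other vertices cyclically. *)
Definition fspec (n INF : nat) (f : nat -> triple) (r m : nat -> nat) : Prop :=
  (r 8 <> 0 /\ forall i, f i = (i, i, Some 0)) \/
  (r 8 = 0 /\ forall i,
     f i = (r 6, (r 6 + i) %% n, val_of INF (m (r 7 + (r 6 + i) %% n)))).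

Definition times (s : config) : seq nat := [seq o.1 | o <- outs s].
Definition lastt (s : config) : nat := last 0 (times s).
Definition dl (D a b : nat) : bool := b <= a + D.
Definition pend (f : nat -> triple) (ov rem : nat) : seq triple :=
  [seq f i | i <- iota ov rem].

Section Tick.

Variables (W : nat) (input : nat -> nat) (n INF ob Sp T D B C : nat).
Variables (f : nat -> triple) (Z : seq triple).
Notation lrun := (lrun W input).

(* The ticks left until the last pending output is emitted are
   [C - tm sigma], as long as there is a pending output.  The instructions
   since the last output are charged to the elapsed ticks, up to [B + x]. *)
Record sim (x : nat) (sigma : st) (s : config) : Prop := Sim {
  sim_reg : forall i, 10 <= i -> reg s i = rg sigma i;
  sim_mem : ram s = mm sigma;
  sim_const : [/\ reg s 10 = 1, reg s 11 = n & reg s 12 = INF];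
  sim_phase : [/\ reg s 7 = ob, reg s 5 = T & reg s 6 < n];
  sim_f : fspec n INF f (reg s) (ram s);
  sim_used : used s <= Sp;
  sim_out : [seq o.2 | o <- outs s] ++ pend f (reg s 2) (reg s 1) = Z;
  sim_cnt : 0 < reg s 0 <= T /\ reg s 2 + reg s 1 <= n;
  sim_credit : 0 < reg s 1 /\ tm sigma + T * (reg s 1 - 1) + reg s 0 = C \/
               reg s 1 = 0 /\ C <= tm sigma;
  sim_delay : 0 < reg s 1 -> path (dl D) 0 (times s) /\
                clock s <= lastt s + B + 20 * (T - reg s 0) + x }.

Lemma sim_weak x y sigma s : x <= y -> sim x sigma s -> sim y sigma s.
Proof.
move=> le_xy [h1 h2 h3 h4 h5 h6 h7 h8 h9 h10]; split=> // /h10[? ?]; split=> //.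
lia.
Qed.

Lemma sim_bump x sigma s : sim x sigma s -> sim x.+1 sigma (lbump s).
Proof.
case: s => pc r m t u os [/= h1 h2 h3 h4 h5 h6 h7 h8 h9 h10].
by split=> //= /h10; rewrite /lastt /times /= => -[? ?]; split=> //; lia.
Qed.

Hypothesis n_gt0 : 0 < n.
Hypothesis n_word : n + n + Sp + T < 2 ^ W.
Hypothesis ob_Sp : ob + n <= Sp.
Hypothesis B_ge : 20 <= B.
Hypothesis D_ge : B + 20 * T <= D.

Lemma run_EMIT pc r m t u os (Q : config -> Prop) :
  r 10 = 1 -> r 11 = n -> r 12 = INF -> r 7 = ob -> r 6 < n ->
  r 2 + r 1 <= n -> 0 < r 1 -> fspec n INF f r m ->
  (forall r' t' u' te,
     (forall i, i \notin [:: 1; 2; 3; 4; 9] -> r' i = r i) ->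
     r' 1 = r 1 - 1 -> r' 2 = r 2 + 1 -> t <= te <= t + 10 ->
     te <= t' <= te + 5 -> u' <= maxn u Sp ->
     Q (Config pc r' m t' u' (rcons os (te, f (r 2))))) ->
  lrun EMIT (Config pc r m t u os) Q.
Proof.
move=> E10 E11 E12 E7 h6 h21 h1 hf HQ.
have W1 : 1 < 2 ^ W by lia.
pose mid s := exists r' t' u' te,
  [/\ s = Config pc r' m t' u' (rcons os (te, f (r 2))),
      (forall i, i \notin [:: 3; 4; 9] -> r' i = r i),
      t <= te <= t + 10, te <= t' <= te + 3 & u' <= maxn u Sp].
apply: run_seq; apply: (@run_conseq _ _ _ _ _ _ _ _ mid); last first.
  move=> s [r' [t' [u' [te [-> Er hte ht' hu]]]]].
  have F10 : r' 10 = 1 by rewrite Er.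
  have F1 : r' 1 = r 1 by rewrite Er.
  have F2 : r' 2 = r 2 by rewrite Er.
  lbin ev_add; lbin ev_sub.
  apply: HQ hte _ hu => //; last by lia.
  - move=> i; rewrite !inE !negb_or => /and5P[i1 i2 i3 i4 i9].
    by rewrite /upd (negbTE i1) (negbTE i2) Er // !inE !negb_or i3 i4.
apply: run_if => //=; case: hf => -[E8 Ef].
  have -> : (r 8 == 0) = false by apply/eqP.
  lbin ev_sub.
  apply: run_ins => //=; rewrite /upd /=.
  eexists _, _, _, _; split.
  - by rewrite Ef; reflexivity.
  - by move=> i; rewrite !inE !negb_or => /and3P[/negbTE-> _ _].
  - by lia.
  - by lia.
  - exact: leq_maxl.
have hv : (r 6 + r 2) %% n < n by rewrite ltn_mod.
rewrite E8 /=; lbin ev_add; lbin ev_mod; lbin ev_add.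
sq; eapply l_read; first by lk.
lbin ev_lt => //.
have hu x : x < n -> maxn u (ob + x).+1 <= maxn u Sp.
  by move=> hx; rewrite geq_max leq_maxl leq_max; apply/orP; right; lia.
apply: run_if => //=; rewrite {1}/upd /=.
have {}Ef := Ef (r 2); rewrite E7 /val_of in Ef.
move: Ef; case: ltnP => hI Ef; apply: run_ins => //=; rewrite /upd /=.
- eexists _, _, _, _; split.
  + by rewrite Ef; reflexivity.
  + by move=> i; rewrite !inE !negb_or => /and3P[/negbTE-> /negbTE-> /negbTE->].
  + by lia.
  + by lia.
  + exact: hu.
- eexists _, _, _, _; split.
  + by rewrite Ef; reflexivity.
  + by move=> i; rewrite !inE !negb_or => /and3P[/negbTE-> /negbTE-> /negbTE->].
  + by lia.
  + by lia.
  + exact: hu.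
Qed.

Lemma sim_tick sigma s : sim 3 sigma s -> lrun TICK s (sim 0 (sbump sigma)).
Proof.
case: s => pc r m t u os [/= h1 h2 [E10 E11 E12] [E7 E5 h6] hf hu ho [hc hn] hcr hd].
lbin ev_sub.
apply: run_if => //=; rewrite {1}/upd /=; case: eqP => c0; last first.
  apply: run_skip; split=> //=.
  - by move=> i hi; rewrite /upd; case: eqP => [E|_]; [lia | apply: h1].
  - by rewrite /upd /=; lia.
  - by rewrite /upd /=; lia.
  - by rewrite /upd /= => /hd; rewrite /lastt /times /= => -[? ?]; split=> //; lia.
have {c0} c1 : r 0 = 1 by lia.
lmove; apply: run_if => //=; rewrite (_ : upd _ _ _ 1 = r 1) //; case: eqP => r1.
  apply: run_skip; split=> //=.
  - by move=> i hi; rewrite /upd; do !(case: eqP => [?|_]; first by lia); apply: h1.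
  - by rewrite /upd /=; lia.
  - by rewrite /upd /=; lia.
  - by rewrite /upd /= r1.
apply: run_EMIT => //=; rewrite ?/upd //=; first by lia.
move=> r' t' u' te; rewrite /upd /= => Er F1 F2 hte ht' hu'.
have [//|pth hck] := hd _; first by lia.
rewrite /lastt /times /= in hck.
have E0 : r' 0 = T by rewrite Er.
have rs i : i \notin [:: 0; 1; 2; 3; 4; 9] -> r' i = r i.
  rewrite inE negb_or => /andP[i0 hi]; rewrite Er //.
  by rewrite (negbTE i0).
split=> //=.
- move=> i hi; rewrite rs ?h1 // !inE !negb_or.
  by do !(apply/andP; split); apply/eqP; lia.
- by split; rewrite rs.
- by split; rewrite rs.
- by rewrite /fspec; rewrite !rs.
- by apply: leq_trans hu' _; rewrite geq_max hu leqnn.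
- rewrite F1 F2 -ho map_rcons -cats1 -catA /= /pend.
  by case: (r 1) r1 => // k _; rewrite subn1 addn1.
- by rewrite E0 F1 F2; lia.
- rewrite E0 F1; case: hcr => [[_ e]|[e _]]; last by lia.
  rewrite c1 in e; case: (posnP (r 1 - 1)) => [e1|e1]; [right | left].
    by rewrite e1 muln0 in e; lia.
  have E : T * (r 1 - 1) = T * (r 1 - 1 - 1) + T.
    by rewrite -mulnSr; congr (_ * _); lia.
  by rewrite E in e; split=> //; lia.
- move=> _; rewrite /lastt /times /= map_rcons rcons_path last_rcons pth E0 /dl.
  by rewrite /=; split; lia.
Qed.

Lemma sim_ins i sigma s : siok Sp ob n i sigma -> sim 0 (sbump sigma) s ->
  sim 1 (sstp W input i sigma) (lstp W input i s).
Proof.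
case: sigma => rs ms ts; case: s => pc r m t u os ok.
case=> /= h1 h2 [E10 E11 E12] [E7 E5 h6] hf hu ho [hc hn] hcr hd.
have hd' : 0 < r 1 -> path (dl D) 0 [seq o.1 | o <- os] /\
    t.+1 <= last 0 [seq o.1 | o <- os] + B + 20 * (T - r 0) + 1.
  by move/hd; rewrite /lastt /times /= => -[? ?]; split=> //; lia.
have reg_upd d v v' : 20 <= d -> v = v' ->
    sim 1 (St (upd rs d v') ms ts.+1) (Config pc (upd r d v) m t.+1 u os).
  move=> hd20 <-.
  have far j : j < 20 -> upd r d v j = r j by move=> hj; apply: upd_far hj hd20.
  split=> /=; rewrite /fspec ?far //.
  by move=> j hj; rewrite /upd; case: eqP => // _; apply: h1.
case: i ok => [d k|d a|o d a b|d a|a b|d a|l|a l|a v d|a v|] //= ok.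
- exact: reg_upd.
- by case/andP: ok => h ha; apply: reg_upd => //; apply: h1.
- by case/and3P: ok => h ha hb; apply: reg_upd => //; rewrite !h1.
- case/and3P: ok => h ha hs; rewrite h1 // h2.
  have [k1 k2 k3 k4 k5 k6 k7 k8 k9 k10] := reg_upd d _ _ h (erefl (ms (rs a))).
  rewrite h2 in k2 k5 *.
  by split=> //=; rewrite geq_max hu.
- case/and4P: ok => ha hb hs hp; rewrite !h1 // h2.
  split=> //=; last 1 first.
  + by rewrite geq_max hu.
  + case: hf => -[h8 Ef]; [left | right]; split=> // j; rewrite Ef //.
    rewrite h2 /upd E7; case: eqP => // E; case/negP: hp; rewrite -E leq_addr /=.
    by rewrite ltn_add2l ltn_mod.
- by case/andP: ok => h ha; apply: reg_upd => //; rewrite h1.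
Qed.

Lemma tk_correct c sigma sigma' : sexec W input Sp ob n c sigma sigma' ->
  forall s, sim 1 sigma s -> lrun (tk c) s (sim 1 sigma').
Proof.
have tick sg s (Q : config -> Prop) : sim 3 sg s ->
    (forall s', sim 0 (sbump sg) s' -> Q s') -> lrun TICK s Q.
  by move=> H HQ; apply: run_conseq (sim_tick H) HQ.
elim=> {c sigma sigma'} /=.
- by move=> sg s H; apply: run_skip.
- move=> i sg ok s H; apply: run_seq; apply: (tick _ _ _ (sim_weak _ H)) => // s' H'.
  by apply: run_ins; [case: i ok {H H'} | apply: sim_ins].
- move=> c1 c2 sg sg1 sg2 _ IH1 _ IH2 s H; apply: run_seq.
  by apply: run_conseq (IH1 _ H) _ => s1 H1; apply: IH2.
- move=> r c1 c2 sg sg' r10 _ IH s H; apply: run_if => //.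
  rewrite (sim_reg H) //.
  suff gen c : (forall s, sim 1 (sbump sg) s -> lrun (tk c) s (sim 1 sg')) ->
      lrun (TICK ;; tk c ;; TICK) (lbump s) (fun s' => sim 1 (sbump sg') (lbump s')).
    by case: eqP IH => _ /gen.
  move=> {}IH; apply: run_seq; apply: (tick _ _ _ (sim_weak _ (sim_bump H))) => // s1 H1.
  apply: run_seq; apply: run_conseq (IH _ (sim_weak _ H1)) _ => // s2 H2.
  by apply: (tick _ _ _ (sim_weak _ H2)) => // s3; apply: sim_bump.
- move=> r c sg r10 r0 s H; apply: run_seq.
  exists (lbump s); first by apply: XWhile0; rewrite ?(sim_reg H).
  by apply: (tick _ _ _ (sim_weak _ (sim_bump H))) => // s3; apply: sim_weak.
- move=> r c sg sg1 sg2 r10 r1 _ IH1 _ IH2 s H.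
  have [s1 X1 H1] : lrun (TICK ;; tk c ;; TICK) (lbump s) (sim 0 (sbump sg1)).
    apply: run_seq; apply: (tick _ _ _ (sim_weak _ (sim_bump H))) => // s1 H1.
    apply: run_seq; apply: run_conseq (IH1 _ (sim_weak _ H1)) _ => // s2 H2.
    by apply: (tick _ _ _ (sim_weak _ H2)).
  have [s2 X2 H2] := IH2 _ (sim_bump H1).
  exists s2 => //; inversion X2 as [| |c1' c2' a b d Xw Xt| | |]; subst.
  by apply: XSeq Xt; apply: XWhile1 X1 Xw; rewrite ?(sim_reg H).
Qed.

End Tick.

(** * The enumeration program *)

Definition FLUSH : cmd := While 1 EMIT.

Definition NEXT : cmd :=
  Move 3 13 ;; Move 13 7 ;; Move 7 3 ;; Move 6 19 ;; Const 8 0 ;; Move 2 10 ;;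
  Bin OpSub 1 11 10 ;; Move 0 5 ;; Bin OpAdd 19 19 10.

Definition pace (c : nat) : nat := 1000 * (c + 4).

Definition DIGITS : cmd :=
  Move 3 11 ;; While 3 (Bin OpAdd 35 35 10 ;; Bin OpShr 3 3 10).

Definition SETUP (c : nat) : cmd :=
  DIGITS ;;
  Const 3 c.+1 ;; Bin OpMul 3 3 35 ;; Bin OpShl 12 10 3 ;;
  Bin OpAdd 18 3 10 ;; Bin OpAdd 18 18 10 ;;
  Bin OpAdd 14 11 11 ;; Bin OpAdd 15 14 11 ;; Bin OpAdd 16 15 11 ;;
  Bin OpAdd 17 16 11 ;; Move 7 11 ;; Write 11 11 ;;
  Bin OpAdd 3 35 10 ;; Const 4 (pace c) ;; Bin OpMul 5 3 4 ;; Move 0 5 ;;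
  Const 8 1 ;; Move 1 11.

Definition ROWS : cmd :=
  Bin OpLt 3 19 11 ;;
  While 3 (tk SSSP ;; FLUSH ;; NEXT ;; Bin OpLt 3 19 11) ;;
  FLUSH.

Definition MAIN (c : nat) : cmd :=
  SETUP c ;; tk (DEGSUM (pace c)) ;; Move 5 32 ;; ROWS.

Definition APSD (c : nat) : cmd :=
  Const 10 1 ;; Input 11 4 ;; If 11 (MAIN c) Skip.

Section Main.

Variables (c W n : nat) (input : nat -> nat) (adj : nat -> seq (nat * nat)).
Variable wmax : nat.

Definition ndig : nat := (trunc_log 2 n).+1.
Definition topb : nat := c.+1 * ndig + 2.
Definition infd : nat := 2 ^ (topb - 2).
Definition cells : nat := (c + 10) * n.
Definition msum : nat := \sum_(v < n) size (adj v).
Definition per0 : nat := pace c * (ndig + 1).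
Definition per : nat := pace c * (msum %/ n + ndig + 1).
Definition gap : nat := 30 * per.
Definition slack : nat := 4 * ndig + 60.
Definition ticks : nat :=
  12 * n + 6 * topb + 50 + n * (200 * topb) + 100 * msum.

Hypothesis n_gt0 : 0 < n.
Hypothesis big : n * n + 3 * n + ndig + cells + pace c * (n + ndig + 1) + 2 < 2 ^ W.
Hypothesis big_inf : infd + wmax < 2 ^ W.
Hypothesis adj_list : forall u, u < n ->
  list_at W input (input (u + u + 1 + 1)) (adj u).
Hypothesis adj_deg : forall u, u < n ->
  input (u + u + 1) = size (adj u) /\ size (adj u) <= n.
Hypothesis adj_ok : forall u z w : nat, u < n -> (z, w) \in adj u ->
  z < n /\ w <= wmax.

Notation lrun := (lrun W input).
Notation dpath := (dpath adj).

Lemma ndig_bounds : 2 ^ ndig.-1 <= n < 2 ^ ndig.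
Proof. exact: trunc_log_bounds. Qed.

Lemma ndig_le : 0 < ndig <= n.
Proof.
apply/andP; split=> //; apply: leq_trans (proj1 (andP ndig_bounds)).
exact: ltn_expl.
Qed.

Lemma topb_le : topb <= (c + 3) * ndig /\ 1 < topb.
Proof.
by have /andP[h _] := ndig_le; rewrite /topb mulSn mulnDl; split; lia.
Qed.

Lemma cells_big : 5 * n + topb + 1 < cells.
Proof.
have /andP[_ h] := ndig_le; rewrite /topb /cells mulSn mulnDl.
have : c * ndig <= c * n by rewrite leq_mul2l h orbT.
lia.
Qed.

Lemma msum_le : msum <= n * n.
Proof.
rewrite /msum; apply: leq_trans (_ : \sum_(j < n) n <= _).
  by apply: leq_sum => j _; case: (adj_deg (ltn_ord j)).
by rewrite sum_nat_const card_ord.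
Qed.

Lemma per_le : per0 <= per <= pace c * (n + ndig + 1).
Proof.
have hq : msum %/ n <= n.
  by apply: leq_trans (leq_div2r n msum_le) _; rewrite mulnK.
rewrite /per0 /per !leq_mul2l; apply/andP; split; apply/orP; right.
  by rewrite leq_add2r leq_addl.
by rewrite !leq_add2r.
Qed.

Lemma per0_ge : 4000 * (ndig + 1) <= per0.
Proof. rewrite /per0 /pace leq_mul2r; apply/orP; right; lia. Qed.

Lemma gap_ge : slack + 20 * per + 60 <= gap.
Proof. have := per_le; have := per0_ge; rewrite /gap /slack; lia. Qed.

(* [per] is chosen so that a quarter of the outputs of a row suffices to cover
   a whole run of Dijkstra's algorithm. *)
Lemma per_ticks : 4 * ticks < per * n.
Proof.
have [h1 _] := topb_le; have /andP[h2 h3] := ndig_le.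
have hm : msum < (msum %/ n + 1) * n by rewrite addn1 ltn_ceil.
have e1 : per * n = pace c * ((msum %/ n + 1) * n + ndig * n).
  by rewrite /per -mulnA -mulnDl; congr (_ * (_ * _)); lia.
apply: leq_trans (_ : pace c * (msum + 1 + ndig * n) <= _); last first.
  by rewrite e1 leq_mul2l leq_add2r addn1 hm orbT.
have e2 : n * topb <= (c + 3) * (ndig * n) by rewrite mulnA [_ * topb]mulnC leq_mul2r h1 orbT.
have e3 : topb <= n * topb by rewrite leq_pmull.
have e4 : n <= ndig * n by rewrite leq_pmull.
have e5 : n * (200 * topb) = 200 * (n * topb) by rewrite mulnCA.
rewrite /ticks e5 /pace; move: (n * topb) e2 e3 => X e2 e3.
move: (ndig * n) e2 e4 => Y e2 e4.
have e6 : (c + 3) * Y = c * Y + 3 * Y by rewrite mulnDl.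
have e7 : 1000 * (c + 4) * (msum + 1 + Y) =
    1000 * (c * Y) + 4000 * Y + 1000 * (c * (msum + 1)) + 4000 * (msum + 1).
  by rewrite -mulnA mulnDl !mulnDr; lia.
by rewrite e7; rewrite e6 in e2; lia.
Qed.

(** * Emptying the list of pending outputs *)

Lemma lrun_used cm s (Q : config -> Prop) :
  lrun cm s (fun s' => used s <= used s' -> Q s') -> lrun cm s Q.
Proof. by case=> s' X q; exists s' => //; apply: q; apply: lexec_used X. Qed.

Lemma run_FLUSH P ob f Z pc r m t u os (Q : config -> Prop) :
  ob + n <= cells ->
  r 10 = 1 -> r 11 = n -> r 12 = infd -> r 7 = ob -> r 6 < n ->
  r 2 + r 1 <= n -> fspec n infd f r m -> u <= cells ->
  [seq o.2 | o <- os] ++ pend f (r 2) (r 1) = Z ->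
  (P -> [/\ 0 < r 1, path (dl gap) 0 [seq o.1 | o <- os]
          & t + 30 <= last 0 [seq o.1 | o <- os] + gap]) ->
  (forall r' t' u' os', (forall i, i \notin [:: 1; 2; 3; 4; 9] -> r' i = r i) ->
     u' <= cells -> [seq o.2 | o <- os'] = Z ->
     (P -> path (dl gap) 0 [seq o.1 | o <- os'] /\
           t' <= last 0 [seq o.1 | o <- os'] + 8) ->
     Q (Config pc r' m t' u' os')) ->
  lrun FLUSH (Config pc r m t u os) Q.
Proof.
move=> hob E10 E11 E12 E7 h6 h21 hf hu ho hP HQ.
pose I k (s : config) := exists r' t' u' os',
  [/\ [/\ s = Config pc r' m t' u' os', (forall i, i \notin [:: 1; 2; 3; 4; 9] -> r' i = r i)
        & r' 2 + r' 1 <= n],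
      u' <= cells, [seq o.2 | o <- os'] ++ pend f (r' 2) (r' 1) = Z,
      k = r' 1
    & P -> path (dl gap) 0 [seq o.1 | o <- os'] /\
       ((0 < r' 1 /\ t' + 30 <= last 0 [seq o.1 | o <- os'] + gap) \/
        t' <= last 0 [seq o.1 | o <- os'] + 7)].
apply: (run_while (I := I) _ _ _ (k := r 1)) => //; last first.
- exists r, t, u, os; split=> // /hP[h1 h2 h3]; split=> //; by left.
- move=> k _ [r' [t' [u' [os' [[-> Er' hn] hu' ho' _ hP']]]]] /= r0.
  apply: HQ => //; first by rewrite -ho' r0 /pend /= cats0.
  by case/hP' => h1 h2; split=> //; lia.
- move=> k _ [r' [t' [u' [os' [[-> Er' hn] hu' ho' -> hP']]]]] /= r0.
  have W1 : n + n + cells + per < 2 ^ W by have := per_le; lia.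
  have hg := gap_ge.
  have hfd : fspec n infd f r' m by rewrite /fspec !Er'.
  have hB : 20 <= slack by rewrite /slack; lia.
  have hD : slack + 20 * per <= gap by lia.
  have r1 : 0 < r' 1 by lia.
  have F10 : r' 10 = 1 by rewrite Er'.
  have F11 : r' 11 = n by rewrite Er'.
  have F12 : r' 12 = infd by rewrite Er'.
  have F7 : r' 7 = ob by rewrite Er'.
  have F6 : r' 6 < n by rewrite Er'.
  apply: (run_EMIT (T := per) input n_gt0 W1 hob hB hD F10 F11 F12 F7 F6 hn r1 hfd).
  move=> r2 t2 u2 te Er2 F1 F2 hte ht2 hu2.
  exists (r2 1); first by rewrite F1; lia.
  exists r2, t2.+1, u2, (rcons os' (te, f (r' 2))); split=> //.
  + by split=> //; [move=> i hi; rewrite Er2 ?Er' | rewrite F1 F2; lia].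
  + by apply: leq_trans hu2 _; rewrite geq_max hu' leqnn.
  + rewrite F1 F2 -ho' map_rcons -cats1 -catA /pend /=.
    by case: (r' 1) r0 => // k' _; rewrite subn1 addn1.
  + move=> /hP'[h1 h2]; rewrite map_rcons rcons_path last_rcons /dl h1 /=.
    by split; lia.
Qed.

(** * The rows of the distance matrix *)

Definition correct (o : triple) : Prop :=
  let: (u, v, d) := o in
  [/\ u < n, v < n
    & match d with
      | Some x => dpath u v x /\ forall e, dpath u v e -> x <= e
      | None => forall e, dpath u v e -> infd <= e
      end].

Definition pairs (k : nat) : seq (nat * nat) :=
  [seq (v, v) | v <- iota 0 n] ++
  flatten [seq [seq (u, (u + i) %% n) | i <- iota 1 n.-1] | u <- iota 0 k].

Definition good (k : nat) (Z : seq triple) : Prop :=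
  [seq o.1 | o <- Z] = pairs k /\ forall o, o \in Z -> correct o.

Definition is_row (k : nat) (d : nat -> nat) : Prop :=
  forall v, v < n -> [/\ d v <= infd, d v < infd -> dpath k v (d v)
                       & forall e, dpath k v e -> d v <= e].

Definition rowf (k : nat) (d : nat -> nat) (i : nat) : triple :=
  (k, (k + i) %% n, val_of infd (d ((k + i) %% n))).

Lemma good_next k Z d : k < n -> good k Z -> is_row k d ->
  good k.+1 (Z ++ pend (rowf k d) 1 (n - 1)).
Proof.
move=> hk [E G] hd; split.
  rewrite map_cat E /pairs -[k.+1]addn1 iotaD map_cat flatten_cat /= cats0 -catA.
  by rewrite subn1 /pend -map_comp.
move=> o; rewrite mem_cat => /orP[/G //|/mapP[i _ ->]].
rewrite /rowf /correct; have hv : (k + i) %% n < n by rewrite ltn_mod.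
have [h1 h2 h3] := hd _ hv; split=> //; rewrite /val_of; case: ltnP => h.
  by split=> //; apply: h2.
by move=> e /h3; apply: leq_trans.
Qed.

Definition diagf (i : nat) : triple := (i, i, Some 0).

Lemma good_diag : good 0 (pend diagf 0 n).
Proof.
split; first by rewrite /pairs /= cats0 /pend -map_comp.
move=> o /mapP[i]; rewrite mem_iota => /andP[_ hi] ->; split=> //.
by split=> //; apply: dpath0.
Qed.

Lemma tk_run T B ob C f Z cm sg s (Q : st -> Prop) :
  T <= per -> 20 <= B <= slack -> ob + n <= cells ->
  srun W input cells ob n cm sg Q ->
  sim n infd ob cells T gap B C f Z 1 sg s ->
  lrun (tk cm) s
    (fun s' => exists2 sg', sim n infd ob cells T gap B C f Z 1 sg' s' & Q sg').
Proof.
move=> hT /andP[B1 B2] hob [sg' X q] H.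
have hW : n + n + cells + T < 2 ^ W by have := per_le; lia.
have hg : B + 20 * T <= gap by have := gap_ge; lia.
by apply: run_conseq (tk_correct n_gt0 hW hob B1 hg X H) _ => s' H'; exists sg'.
Qed.

Definition hslack : nat := 4 * ndig + 55.

Definition head (x k : nat) (s : config) : Prop := exists f Z C ob kb,
  [/\ (kb = 0 /\ ob = n) \/ (kb = n /\ ob = 0),
      sim n infd ob cells per gap hslack C f Z x (St (reg s) (ram s) 0) s,
      env n topb kb infd (reg s) /\ reg s 19 = k,
      good k Z
    & 1 < n -> ticks < C].

Definition final (s : config) : Prop :=
  [/\ good n [seq o.2 | o <- outs s], used s <= cells
    & 1 < n -> path (dl gap) 0 (times s) /\ clock s <= lastt s + 9].

Lemma sim_slack T B B' C ob f Z x x' sg s : B + x <= B' + x' ->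
  sim n infd ob cells T gap B C f Z x sg s ->
  sim n infd ob cells T gap B' C f Z x' sg s.
Proof.
move=> le_B [h1 h2 h3 h4 h5 h6 h7 h8 h9 h10]; split=> // /h10[? ?]; split=> //.
lia.
Qed.

Lemma kbob_cells kb ob : (kb = 0 /\ ob = n) \/ (kb = n /\ ob = 0) -> ob + n <= cells.
Proof. have := cells_big; lia. Qed.

Lemma head_weak x k s : head x k s -> head x.+1 k s.
Proof.
case=> f [Z [C [ob [kb [h1 S h2 h3 h4]]]]]; exists f, Z, C, ob, kb; split=> //.
by apply: (sim_slack _ S); lia.
Qed.

Lemma head_bump x k s : head x k s -> head x.+1 k (lbump s).
Proof.
case: s => pc r m t u os [f [Z [C [ob [kb [h1 S h2 h3 h4]]]]]].
by exists f, Z, C, ob, kb; split=> //; apply: (sim_bump S).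
Qed.

Lemma run_head k s (Q : config -> Prop) : head 1 k s ->
  (forall s', head 2 k s' -> reg s' 3 = (k < n) -> Q s') ->
  lrun (Bin OpLt 3 19 11) s Q.
Proof.
case: s => pc r m t u os [f [Z [C [ob [kb [hkb S [hE E19] hZ hC]]]]]] HQ.
have W1 : 1 < 2 ^ W by lia.
have [E10 E11 E12 E13 _] := hE; rewrite /= in E10 E11 E12 E13 E19.
lbin ev_lt => //; apply: HQ => //.
exists f, Z, C, ob, kb; split=> //.
case: S => /= h1 h2 h3 h4 h5 h6 h7 h8 h9 h10; split=> //= /h10.
by rewrite /upd /lastt /times /= => -[? ?]; split=> //; lia.
Qed.

Lemma run_NEXT k kb ob pc r m t u os Z (Q : config -> Prop) :
  (kb = 0 /\ ob = n) \/ (kb = n /\ ob = 0) ->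
  env n topb kb infd r -> r 19 = k -> r 7 = ob -> r 5 = per -> k < n ->
  u <= cells -> [seq o.2 | o <- os] = Z -> good k Z ->
  is_row k (fun v => m (kb + v)) ->
  (1 < n -> path (dl gap) 0 [seq o.1 | o <- os] /\
            t <= last 0 [seq o.1 | o <- os] + 20) ->
  (forall s', head 1 k.+1 s' -> Q s') ->
  lrun NEXT (Config pc r m t u os) Q.
Proof.
move=> hkb hE E19 E7 E5 hk hu ho hZ hrow hP HQ.
have hW : n + n + cells + per < 2 ^ W by have := per_le; lia.
have p0 := per0_ge; have pl := per_le.
have [E10 E11 E12 E13 [E14 E15 E16 E17 E18]] := hE.
lmove; lmove; lmove; lmove; sq; eapply l_const; [reflexivity | lia | ].
lmove; lbin ev_sub; lmove; lbin ev_add.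
apply: HQ.
exists (rowf k (fun v => m (kb + v))), (Z ++ pend (rowf k (fun v => m (kb + v))) 1 (n - 1)),
  (per * (n - 1)), kb, ob; split.
- by lia.
- split=> //=.
  + by right; split.
  + by rewrite /upd /= ho.
  + by rewrite /upd /=; lia.
  + rewrite /upd /=; case: (posnP (n - 1)) => n1; [right | left]; split=> //.
      by rewrite n1 muln0.
    have -> : n - 1 = (n - 1 - 1).+1 by lia.
    by rewrite mulnSr subn1 /=; lia.
  + rewrite /upd /lastt /times /= => n1; have [|h1 h2] := hP; first by lia.
    by split=> //; rewrite /hslack; lia.
- by split; [split=> //; split | rewrite /upd /= addn1].
- exact: good_next.
- move=> n1; have h := per_ticks.
  have h2 : per * n <= per * (2 * (n - 1)) by rewrite leq_mul2l; apply/orP; right; lia.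
  by rewrite mulnCA in h2; lia.
Qed.

Lemma run_ROWS s : head 1 0 s -> lrun ROWS s final.
Proof.
have hW : cells < 2 ^ W by lia.
have gg := gap_ge; have p0 := per0_ge; have pl := per_le.
have B1 : 20 <= slack <= slack by rewrite /slack; lia.
pose I k' (s : config) := exists k,
  [/\ k <= n, k' = n - k, head 3 k s & reg s 3 = (k < n)].
move=> H0; apply: run_seq; apply: (run_head H0) => s1 H1 E3.
apply: run_seq; apply: (run_while (I := I) _ _ _ (k := n)) => //; last first.
- by exists 0; rewrite subn0; split=> //; apply: head_weak H1.
- move=> k' s2 [k [hk _ H2 F3]] r0.
  have {hk} nk : k = n by move: F3; rewrite r0; case: ltnP => //; lia.
  move: H2; rewrite {}nk; case: s2 {F3 r0} => pc r m t u os.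
  case=> f [Z [C [ob [kb [hkb S [hE E19] hZ hC]]]]].
  case: S => /= h1 h2 [k1 k2 k3] [k4 k5 k6] h5 h6 h7 [_ h8] h9 h10.
  have hl : 1 < n -> 0 < r 1 by move/hC => h; case: h9 => -[] //; lia.
  apply: (run_FLUSH (P := 1 < n) (kbob_cells hkb) k1 k2 k3 k4 k6 h8 h5 h6 h7).
    move=> n1; have [//|q1 q2] := h10 _; first exact: hl.
    split=> //; first exact: hl.
    by rewrite /lastt /times /= in q2; rewrite /hslack /slack in q2 gg; lia.
  move=> r' t' u' os' _ hu' ho' hP'; split=> //=; first by rewrite ho'.
  by move=> /hP'[q1 q2]; split=> //; rewrite /lastt /times /=; lia.
move=> k' s2 [k [hk -> H2 F3]] r0.
have {}hk : k < n by move: r0; rewrite F3; case: (_ < _).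
case: s2 H2 r0 {F3} => pc r m t u os.
case=> f [Z [C [ob [kb [hkb S [hE E19] hZ hC]]]]] /= _.
have hob := kbob_cells hkb.
have [hl1 hl2] := topb_le.
apply: run_seq.
have S' : sim n infd ob cells per gap slack C f Z 1 (St r m 0) (lbump (Config pc r m t u os)).
  by apply: (sim_slack _ (sim_bump S)); rewrite /hslack /slack; lia.
pose Q1 sg' := [/\ forall i, i < 20 -> rg sg' i = r i,
   is_row k (fun v => mm sg' (kb + v)) & tm sg' <= ticks].
have X : srun W input cells ob n SSSP (St r m 0) Q1.
  apply: (run_SSSP (s := k) n_gt0 hkb cells_big hW hl2 (erefl _) big_inf hk
           adj_list adj_ok) hE E19 _.
  by move=> r' m' t' Er' hrow ht'; split.
apply: run_conseq (tk_run (leqnn per) B1 hob X S') _ => s3 [sg' S3 [Er3 hrow ht3]].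
case: s3 S3 => pc3 r3 m3 t3 u3 os3.
case=> /= h1 h2 [k1 k2 k3] [k4 k5 k6] h5 h6 h7 [_ h8] h9 h10.
have hl : 1 < n -> 0 < r3 1 by move/hC => h; case: h9 => -[] //; lia.
apply: run_seq; apply: (run_FLUSH (P := 1 < n) hob k1 k2 k3 k4 k6 h8 h5 h6 h7).
  move=> n1; have [//|q1 q2] := h10 _; first exact: hl.
  split=> //; first exact: hl.
  by rewrite /lastt /times /= in q2; lia.
move=> r4 t4 u4 os4 Er4 hu4 ho4 hP4.
have rr i : 10 <= i < 20 -> r4 i = r i.
  move=> hi; rewrite Er4; last by rewrite !inE !negb_or; do !(apply/andP; split); apply/eqP; lia.
  by rewrite h1 ?Er3 //; lia.
have hE4 : env n topb kb infd r4 by move: hE; rewrite /env /= !rr.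
apply: run_seq; apply: (@run_NEXT k kb ob _ _ _ _ _ _ Z _ hkb hE4 _ _ _ hk hu4 ho4 hZ).
- by rewrite rr.
- by rewrite Er4.
- by rewrite Er4.
- by rewrite h2.
- by move=> /hP4[q1 q2]; split=> //; lia.
move=> s5 H5; apply: (run_head H5) => s6 H6 E6.
exists (n - k.+1); first by lia.
by exists k.+1; split=> //; [apply: head_bump | case: s6 H6 E6].
Qed.

Lemma run_DIGITS pc r m t u os (Q : config -> Prop) :
  r 10 = 1 -> r 11 = n -> r 35 = 0 ->
  (forall r' t', (forall i, i != 3 -> i != 35 -> r' i = r i) -> r' 35 = ndig ->
     t' <= t + 4 * ndig + 2 -> Q (Config pc r' m t' u os)) ->
  lrun DIGITS (Config pc r m t u os) Q.
Proof.
move=> E10 E11 E35 HQ.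
have hn : n < 2 ^ W by lia.
have hd : ndig < 2 ^ W by lia.
have /andP[b1 b2] := ndig_bounds; have /andP[d1 d2] := ndig_le.
lmove.
pose I k (s : config) := exists i r' t',
  [/\ s = Config pc r' m t' u os, (forall j, j != 3 -> j != 35 -> r' j = r j),
      i <= ndig /\ k = ndig - i, r' 3 = n %/ 2 ^ i /\ r' 35 = i
    & t' <= t + 4 * i + 1].
apply: (run_while (I := I) _ _ _ (k := ndig)) => //; last first.
- exists 0; eexists _, _; split; [reflexivity | | | | lia].
  + by move=> j /negbTE h _; rewrite /upd h.
  + by rewrite subn0.
  + by rewrite /upd /= expn0 divn1.
- move=> k s [i [r' [t' [-> Er [hi _] [F3 F35] ht]]]] /= r0.
  have ni : i = ndig.
    apply/eqP; rewrite eqn_leq hi /= leqNgt; apply/negP => lt_i.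
    move: r0; rewrite F3 => /eqP; rewrite -leqn0 leqNgt divn_gt0 ?expn_gt0 //.
    by case/negP; apply: leq_trans b1; rewrite leq_exp2l //; lia.
  by apply: HQ; rewrite ?F35 //; lia.
move=> k s [i [r' [t' [-> Er [hi ->] [F3 F35] ht]]]] /= r0.
have lt_i : i < ndig.
  rewrite ltn_neqAle hi andbT; apply/eqP => h; case: r0.
  by rewrite F3 h divn_small.
have F10 : r' 10 = 1 by rewrite Er.
have hq : r' 3 < 2 ^ W by rewrite F3; apply: leq_ltn_trans (leq_div _ _) hn.
lbin ev_add; sq; eapply l_bin; [lk | lk | apply: ev_shr => // | ].
  by rewrite -F3.
exists (ndig - i.+1); first by lia.
exists i.+1; eexists _, _; split; [reflexivity | | | | lia].
- by move=> j /negbTE h3 /negbTE h35; rewrite /upd h3 h35 Er // ?h3 ?h35.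
- by split.
- by rewrite /upd /= addn1; split=> //; rewrite -[i.+1]addn1 expnD divnMA.
Qed.

Definition slack0 : nat := 4 * ndig + 40.

Lemma run_SETUP pc r m t (Q : config -> Prop) :
  r 10 = 1 -> r 11 = n -> t <= 5 ->
  (forall i, i != 10 -> i != 11 -> r i = 0) ->
  (forall s, sim n infd n cells per0 gap slack0 (per0 * n) diagf (pend diagf 0 n)
               1 (St (reg s) (ram s) 0) s ->
     env n topb 0 infd (reg s) -> reg s 19 = 0 -> reg s 35 = ndig -> n < used s ->
     Q s) ->
  lrun (SETUP c) (Config pc r m t 0 [::]) Q.
Proof.
move=> E10 E11 ht E0 HQ.
have hd := ndig_le; have hs := cells_big; have [htb tb1] := topb_le.
have hp := per0_ge; have hpl := per_le.
apply: run_seq; apply: run_DIGITS => //; first exact: E0.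
move=> r1 t1 Er F35 ht1.
have F10 : r1 10 = 1 by rewrite Er.
have F11 : r1 11 = n by rewrite Er.
have F0 i : i != 3 -> i != 35 -> i != 10 -> i != 11 -> r1 i = 0.
  by move=> *; rewrite Er // E0.
have hc : c.+1 * ndig + 2 = topb by [].
have infE : 2 ^ (c.+1 * ndig) = infd by rewrite /infd /topb addnK.
have hc1 : c.+1 <= c.+1 * ndig by rewrite leq_pmulr; lia.
have hpc : pace c <= pace c * (n + ndig + 1) by rewrite leq_pmulr; lia.
sq; eapply l_const; [reflexivity | lia | ].
lbin ev_mul; sq; eapply l_bin; [lk | lk | apply: ev_shl; rewrite mul1n infE; lia | ].
rewrite mul1n infE.
lbin ev_add; lbin ev_add; lbin ev_add; lbin ev_add; lbin ev_add; lbin ev_add.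
lmove; sq; eapply l_write; [lk | lk | ].
lbin ev_add.
have e0 : (ndig + 1) * pace c = per0 by rewrite mulnC.
sq; eapply l_const; [reflexivity | lia | ].
sq; eapply l_bin; [lk | lk | apply: ev_mul; rewrite e0; lia | ].
rewrite e0.
lmove; sq; eapply l_const; [reflexivity | lia | ].
lmove.
apply: HQ; rewrite /= ?maxn0.
- split=> //=.
  + by split; rewrite /upd //= F0.
  + by left.
  + by lia.
  + by rewrite /upd /= F0.
  + by rewrite /upd /= F0 //; lia.
  + left; rewrite /upd /=; split=> //.
    have -> : n = (n - 1).+1 by lia.
    by rewrite mulnSr subn1 /=; lia.
  + by rewrite /upd /lastt /times /= /slack0; split=> //; lia.
- split; rewrite /upd //=; first by rewrite F0.
  by split; rewrite /upd //=; lia.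
- by rewrite /upd /= F0.
- by rewrite /upd.
- by lia.
Qed.

Lemma run_MAIN pc r m t (Q : config -> Prop) :
  r 10 = 1 -> r 11 = n -> t <= 5 ->
  (forall i, i != 10 -> i != 11 -> r i = 0) ->
  (forall s, final s -> n < used s -> Q s) ->
  lrun (MAIN c) (Config pc r m t 0 [::]) Q.
Proof.
move=> E10 E11 ht E0 HQ.
have hd := ndig_le; have hs := cells_big.
have hp := per0_ge; have hpl := per_le.
have hpc : pace c <= pace c * (n + ndig + 1) by rewrite leq_pmulr; lia.
apply: run_seq; apply: run_SETUP => // s S hE E19 E35 hu.
apply: lrun_used.
have hob : n + n <= cells by lia.
have B1 : 20 <= slack0 <= slack by rewrite /slack0 /slack; lia.
have p01 : per0 <= per by lia.
pose Q1 sg' := [/\ forall i, i < 20 -> rg sg' i = reg s i, rg sg' 32 = per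
                 & tm sg' <= 8 * n + 12].
have X : srun W input cells n n (DEGSUM (pace c)) (St (reg s) (ram s) 0) Q1.
  have [h10 h11 _ _ _] := hE.
  apply: (run_DEGSUM cells n (L1 := ndig)) => //; try lia.
    by move=> i /adj_deg[-> h].
  move=> r' t' Er' E32 ht'; split=> //=; rewrite E32 /per; congr (_ * (_ %/ _ + _ + _)).
  by apply: eq_bigr => i _; case: (adj_deg (ltn_ord i)).
apply: run_seq; apply: run_conseq (tk_run p01 B1 hob X S) _ => s1 [sg' S1 [Er1 E32 ht1]].
have r10 i : 10 <= i < 20 -> reg s1 i = reg s i.
  by move=> hi; rewrite (sim_reg S1) ?Er1; lia.
case: s1 S1 r10 => pc1 r1 m1 t1 u1 os1 S1 /= r10.
case: S1 => /= h1 h2 [k1 k2 k3] [k4 k5 k6] h5 h6 h7 [h8a h8] h9 h10.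
have F32 : r1 32 = per by rewrite h1.
lmove.
apply: run_conseq (run_ROWS _) _; last by move=> s' hf hu'; apply: HQ => //; lia.
exists diagf, (pend diagf 0 n), (if 0 < r1 1 then per * (r1 1 - 1) + r1 0 else 0), n, 0.
split.
- by left.
- split=> //=.
  + by rewrite /upd /=; lia.
  + rewrite /upd /=; case: (posnP (r1 1)) => h; [right | left]; split=> //.
  + rewrite /upd /lastt /times /= => /h10[q1 q2]; split=> //.
    by rewrite /lastt /times /= in q2; rewrite /hslack; rewrite /slack0 in q2; lia.
- by split; [move: hE; rewrite /env /upd /= !r10 | rewrite /upd /= r10].
- exact: good_diag.
move=> n1; have hpt := per_ticks.
have q0 : 80 * n <= per0 * n by rewrite leq_mul2r; apply/orP; right; lia.
have q1 : 80 * n < per0 * n by rewrite ltn_mul2r; apply/andP; split; lia.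
case: h9 => [[hr e]|[hr e]]; last by lia.
rewrite hr; set y := r1 1 - 1 in e *.
have hy : n <= 4 * y.
  rewrite leqNgt; apply/negP => lt_y.
  have a1 : per0 * n <= per0 * (4 * n - 4 * (y + 1)) by rewrite leq_mul2l; apply/orP; right; lia.
  have a2 : per0 * (4 * n - 4 * (y + 1)) + 4 * (per0 * y) + 4 * per0 = 4 * (per0 * n).
    have -> : 4 * (per0 * y) = per0 * (4 * y) by lia.
    have -> : 4 * (per0 * n) = per0 * (4 * n) by lia.
    have -> : 4 * per0 = per0 * 4 by lia.
    by rewrite -!mulnDr; congr (_ * _); lia.
  by lia.
have : per * n <= per * (4 * y) by rewrite leq_mul2l hy orbT.
by rewrite mulnCA; lia.
Qed.

End Main.

(** * Paths of the input graph *)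

Lemma path_weight_rcons n (G : wgraph n) u p v :
  path_weight G u (rcons p v) = path_weight G u p + wt G (last u p) v.
Proof. by elim: p u => [|w p IH] u /=; [rewrite addn0 | rewrite IH addnA]. Qed.

Lemma path_weight_le n (G : wgraph n) b u p : weights_le G b ->
  path (edge G) u p -> path_weight G u p <= size p * b.
Proof.
move=> hb; elim: p u => //= v p IH u /andP[e /IH h].
by rewrite mulSn leq_add // hb.
Qed.

Lemma short_path n (G : wgraph n) b u v p : weights_le G b -> uv_path G u v p ->
  exists2 p', uv_path G u v p' & path_weight G u p' <= n.-1 * b.
Proof.
move=> hb [hp hl]; case: (shortenP hp) hl => p' hp' up' _ hl.
exists p'; first by split.
apply: leq_trans (path_weight_le hb hp') _; rewrite leq_mul2r; apply/orP; right.
have := max_card (mem (u :: p')); rewrite (card_uniqP up') card_ord /=.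
by move=> h; rewrite -ltnS prednK //; apply: leq_trans h.
Qed.

Section Bridge.

Variables (c n : nat) (G : wgraph n) (adj : nat -> seq (nat * nat)).
Hypothesis adjP : forall u : 'I_n,
  perm_eq (adj u) [seq (val v, wt G u v) | v <- enum 'I_n & edge G u v].
Hypothesis Gw : weights_le G (n ^ c).

Lemma mem_adj (u : 'I_n) (z w : nat) :
  reflect (exists v : 'I_n, [/\ edge G u v, z = v & w = wt G u v]) ((z, w) \in adj u).
Proof.
rewrite (perm_mem (adjP u)); apply: (iffP mapP) => [[v]|[v [e -> ->]]].
  by rewrite mem_filter => /andP[e _] [-> ->]; exists v.
by exists v => //; rewrite mem_filter e mem_enum.
Qed.

Lemma size_adj (u : 'I_n) : size (adj u) = outdeg G u.
Proof.
rewrite (perm_size (adjP u)) size_map size_filter -sum1_count big_enum_cond /=.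
by rewrite sum1_card.
Qed.

Lemma dpath_path (u : 'I_n) v d : dpath adj u v d ->
  exists p z, [/\ uv_path G u z p, val z = v & path_weight G u p = d].
Proof.
elim=> [|x e z w _ [p [y [[hp hl] <- <-]]] /mem_adj[v' [hv -> ->]]].
  by exists [::], u; split.
exists (rcons p v'), v'; split=> //.
  by split; [rewrite rcons_path hp hl | rewrite last_rcons].
by rewrite path_weight_rcons hl.
Qed.

Lemma path_dpath (u v : 'I_n) p : uv_path G u v p -> dpath adj u v (path_weight G u p).
Proof.
elim/last_ind: p v => [|p z IH] v [] /=; first by move=> _ <-; apply: dpath0.
rewrite rcons_path last_rcons path_weight_rcons => /andP[hp e] <-.
by apply: dpathS (IH (last u p) _) _; [split | apply/mem_adj; exists z].
Qed.

Lemma correct_is_dist (u v : 'I_n) d : 0 < n ->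
  correct c n adj (val u, val v, d) -> is_dist G u v d.
Proof.
move=> n0 [_ _]; case: d => [x [hx hmin]|hinf] /=.
  split; last by move=> p /path_dpath; apply: hmin.
  by have [p [z [hp /val_inj <- hw]]] := dpath_path hx; exists p.
move=> p hp; have [p' hp' hw] := short_path Gw hp.
have := leq_trans (hinf _ (path_dpath hp')) hw; apply/negP; rewrite -ltnNge.
have /andP[_ b2] := @ndig_bounds n n0.
rewrite /infd /topb addnK [c.+1 * _]mulnC expnM.
have h : n.-1 * n ^ c <= n * n ^ c by rewrite leq_mul2r leq_pred orbT.
by apply: leq_ltn_trans h _; rewrite -expnS ltn_exp2r.
Qed.

End Bridge.

Lemma perm_pairs n : 0 < n ->
  perm_eq (pairs n n) [seq (val u, val v) | u <- enum 'I_n, v <- enum 'I_n].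
Proof.
move=> n0; rewrite perm_sym.
have -> : [seq (val u, val v) | u <- enum 'I_n, v <- enum 'I_n] =
          [seq (u, v) | u <- iota 0 n, v <- iota 0 n].
  by rewrite -val_enum_ord allpairs_mapl allpairs_mapr.
have U : uniq [seq (u, v) | u <- iota 0 n, v <- iota 0 n].
  by apply: allpairs_uniq; rewrite ?iota_uniq // => -[? ?] [? ?].
have sub : {subset [seq (u, v) | u <- iota 0 n, v <- iota 0 n] <= pairs n n}.
  move=> _ /allpairsP[[u v] [/= + + ->]]; rewrite !mem_iota !add0n => /andP[_ hu] /andP[_ hv].
  rewrite /pairs mem_cat; apply/orP; case: (u =P v) => [->|ne].
    by left; apply/mapP; exists v => //; rewrite mem_iota.
  right; apply/flattenP; exists [seq (u, (u + i) %% n) | i <- iota 1 n.-1].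
    by apply/mapP; exists u => //; rewrite mem_iota.
  apply/mapP; exists ((v + n - u) %% n).
    rewrite mem_iota add1n prednK // ltn_mod n0 andbT lt0n; apply/eqP => h.
    case: (ltnP u v) => huv.
      have e : v + n - u = (v - u) + n by lia.
      by move: h; rewrite e modnDr modn_small; lia.
    by move: h; rewrite modn_small; lia.
  congr (_, _); rewrite modnDmr; have -> : u + (v + n - u) = v + n by lia.
  by rewrite modnDr modn_small.
have sz : size (pairs n n) = n * n.
  rewrite /pairs size_cat size_map size_iota.
  rewrite -[flatten _]/([seq (u, (u + i) %% n) | u <- iota 0 n, i <- iota 1 n.-1]).
  by rewrite size_allpairs !size_iota -mulnS prednK.
have [|e1 e2] := uniq_min_size U sub.
  by rewrite sz size_allpairs !size_iota.
by apply: (uniq_perm U _ e2); rewrite -(eq_uniq e1 e2).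
Qed.

Section Instance.

Variables (c W n : nat) (G : wgraph n) (input mem0 : nat -> nat).
Hypothesis n_gt0 : 0 < n.
Hypothesis inst : instance c (c + 20) W G input mem0.

Definition dbound (c n : nat) (G : wgraph n) : nat :=
  30 * (pace c * ((\sum_u outdeg G u) %/ n + ndig n + 1)).

Lemma word_bounds : n * n + 3 * n + ndig n + cells c n
    + pace c * (n + ndig n + 1) + 2 < 2 ^ W /\ infd c n + n ^ c < 2 ^ W.
Proof.
have [_ hk _ _] := inst.
have /andP[b1 b2] := ndig_bounds n_gt0; have /andP[d1 d2] := ndig_le n_gt0.
pose X := 2 ^ ndig n; rewrite -/X in b2.
have X1 : 2 <= X by apply: leq_trans b2.
have hX : X ^ (c + 20) <= 2 ^ W by rewrite /X -expnM leq_exp2l // mulnC.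
have mono i j : i <= j -> X ^ i <= X ^ j by move=> h; rewrite leq_exp2l.
have c2 : c.+1 <= 2 ^ c by apply: ltn_expl.
split; apply: leq_trans hX.
  have n2 : n <= n * n by rewrite leq_pmull.
  have cn : c * n <= c * (n * n) by rewrite leq_mul2l n2 orbT.
  have cd : c * ndig n <= c * n by rewrite leq_mul2l d2 orbT.
  have cnn : c <= c * (n * n) by rewrite leq_pmulr // muln_gt0 n_gt0.
  have e1 : pace c * (n + ndig n + 1) =
      1000 * (c * n) + 1000 * (c * ndig n) + 1000 * c + 4000 * (n + ndig n + 1).
    by rewrite /pace -mulnA mulnDl !mulnDr muln1; lia.
  have e2 : cells c n = c * n + 10 * n by rewrite /cells mulnDl.
  apply: (@leq_ltn_trans (4 * (4000 * (c.+1 * (n * n))))).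
    by rewrite e1 e2 mulSn; lia.
  apply: (@leq_ltn_trans (2 ^ 14 * (c.+1 * (n * n)))).
    have h12 : 4000 <= 2 ^ 12 by rewrite !expnS expn0; lia.
    by rewrite -[14]/(2 + 12) expnD -[X in _ <= X]mulnA leq_mul2l /= leq_mul2r h12 orbT.
  apply: (@leq_trans (X ^ (14 + c + 2))); last by apply: mono; lia.
  rewrite 2!expnD -mulnA; apply: (@leq_trans (2 ^ 14 * (X ^ c * X ^ 2))); last first.
    by rewrite leq_mul2r leq_exp2r ?X1 ?orbT.
  rewrite ltn_pmul2l ?expn_gt0 //.
  apply: leq_ltn_trans (_ : X ^ c * (n * n) < _).
    rewrite leq_mul2r; apply/orP; right; apply: leq_trans c2 _.
    by case: (posnP c) => [->|c0]; rewrite ?expn0 // leq_exp2r.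
  rewrite ltn_pmul2l ?expn_gt0 ?(ltnW X1) //.
  by rewrite -mulnn ltn_mul.
have h1 : n ^ c <= X ^ c.+1.
  apply: (@leq_trans (X ^ c)); last exact: mono.
  by case: (posnP c) => [->|c0]; rewrite ?expn0 // leq_exp2r // ltnW.
have h2 : infd c n = X ^ c.+1 by rewrite /infd /topb addnK mulnC expnM.
have h3 : X ^ c.+1 * 2 <= X ^ c.+2 by rewrite [X ^ c.+2]expnSr leq_mul2l X1 orbT.
have h4 : X ^ c.+2 < X ^ (c + 20) by rewrite ltn_exp2l //; lia.
by rewrite h2; lia.
Qed.

Lemma APSD_run : exists s,
  [/\ halts_with W (comp 0 (APSD c)) input mem0 s,
      enumerates_APSD G [seq o.2 | o <- outs s],
      n < used s, used s <= (c + 10) * n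
    & 1 < n -> path (dl (dbound c G)) 0 (rcons (times s) (clock s))].
Proof.
have [Gw hk [hin h0 hadj] hm] := inst.
have [big big_inf] := word_bounds.
have [f [f1 f2]] : exists f : 'I_n -> seq (nat * nat),
    (forall u : 'I_n, list_at W input (input u.*2.+2) (f u)) /\
    (forall u : 'I_n, perm_eq (f u) [seq (val v, wt G u v) | v <- enum 'I_n & edge G u v]).
  have [|f h1 h2] := @fin_all_exists2 'I_n (fun=> seq (nat * nat))
    (fun u l => list_at W input (input u.*2.+2) l)
    (fun u l => perm_eq l [seq (val v, wt G u v) | v <- enum 'I_n & edge G u v]).
    by move=> u; have [_ [l h1 h2]] := hadj u; exists l.
  by exists f.
pose adj v := if insub v is Some u then f u else [::].
have adjE (u : 'I_n) : adj u = f u by rewrite /adj valK.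
have adjP (u : 'I_n) : perm_eq (adj u) [seq (val v, wt G u v) | v <- enum 'I_n & edge G u v].
  by rewrite adjE.
have a1 u : u < n -> list_at W input (input (u + u + 1 + 1)) (adj u).
  by move=> hu; have := f1 (Ordinal hu); rewrite -adjE -addnn -2!addn1.
have a2 u : u < n -> input (u + u + 1) = size (adj u) /\ size (adj u) <= n.
  move=> hu; have [+ _] := hadj (Ordinal hu); rewrite -addnn -addn1 /= => ->.
  rewrite (size_adj adjP (Ordinal hu)); split=> //.
  by rewrite /outdeg; apply: leq_trans (max_card _) _; rewrite card_ord.
have a3 (u z w : nat) : u < n -> (z, w) \in adj u -> z < n /\ w <= n ^ c.
  by move=> hu /(mem_adj adjP (Ordinal hu))[v [e -> ->]]; split=> //; apply: Gw.
have hg : gap c n adj = dbound c G.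
  have hs : msum n adj = \sum_u outdeg G u.
    by apply: eq_bigr => i _; rewrite (size_adj adjP).
  by rewrite /gap /per hs.
have W1 : 1 < 2 ^ W by lia.
have [s [hf hu] hX] : exists2 s, final c n adj s /\ n < used s &
    lexec W input (APSD c) (init mem0) (lbump s).
  suff [s' X [s [hf hu] Es]] : run lok (lstp W input) xpredT reg lbump (APSD c) (init mem0)
     (fun s' => exists2 s, final c n adj s /\ n < used s & s' = lbump s).
    by exists s; rewrite -?Es.
  sq; eapply l_const; [reflexivity | done | ].
  sq; eapply l_input; [lk | exact: h0 | ].
  apply: run_if => //=; rewrite {1}/upd /=.
  have -> : (n == 0) = false by apply/eqP; lia.
  apply: (run_MAIN n_gt0 big big_inf a1 a2 a3) => //.
    by move=> i /negbTE h10 /negbTE h11; rewrite /upd h11 h10.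
  by move=> s hs hu; exists s.
move: (comp_halts hX); move: (csize (APSD c)) => pc hh.
exists (setpc pc (lbump s)); case: s hf hu {hX} hh => pc0 r m t u os.
case=> [[hZ1 hZ2] husp hd] hu hh.
split; [exact: hh | | exact: hu | exact: husp | ].
- split; first by apply: (perm_trans _ (perm_pairs n_gt0)); rewrite -hZ1.
  by move=> x y d hin'; apply: (correct_is_dist adjP Gw n_gt0); apply: hZ2.
- move=> n1; have [h1 h2] := hd n1.
  have := gap_ge n_gt0 big big_inf a2; rewrite hg in h1 *.
  by rewrite /lastt /times /= in h1 h2 *; rewrite rcons_path h1 /dl /=; lia.
Qed.

End Instance.

Lemma dbound_le c n (G : wgraph n) : 1 < n ->
  ((dbound c G)%:R <= (90 * pace c)%:R * (avg_deg G + (trunc_log 2 n)%:R) :> rat)%R.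
Proof.
move=> n1; have L0 : 0 < trunc_log 2 n by rewrite trunc_log_gt0.
rewrite /avg_deg; set m := \sum_u _.
have h : dbound c G <= 90 * pace c * (m %/ n + trunc_log 2 n).
  have -> : 90 * pace c * (m %/ n + trunc_log 2 n) =
      30 * (pace c * (3 * (m %/ n + trunc_log 2 n))) by lia.
  rewrite /dbound -/m /ndig; move: (m %/ n) => q.
  by do 2![rewrite leq_mul2l; apply/orP; right]; lia.
apply: Order.POrderTheory.le_trans (_ : (90 * pace c * (m %/ n + trunc_log 2 n))%:R <= _)%R.
  by rewrite Num.Theory.ler_nat.
rewrite GRing.natrM Num.Theory.ler_wpM2l ?Num.Theory.ler0n // GRing.natrD.
rewrite Num.Theory.lerD2r Num.Theory.ler_pdivlMr ?Num.Theory.ltr0n ?(ltnW n1) //.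
by rewrite -GRing.natrM Num.Theory.ler_nat leq_trunc_div.
Qed.

Definition empty_graph (n : nat) : wgraph n :=
  @WGraph n true (fun _ _ => false) (fun _ _ => 0) (fun h => False_ind _ (notF h)).

Lemma empty_instance c k W n : n < 2 ^ W -> k * (trunc_log 2 n).+1 <= W ->
  instance c k W (empty_graph n) (fun a => if a == 0 then n else 0) (fun=> 0).
Proof.
move=> hn hk; split=> // [|a]; last by rewrite expn_gt0.
split=> // [a|u]; first by case: eqP => // _; rewrite expn_gt0.
split; first by rewrite /outdeg /= eq_card0.
by exists [::] => //=; rewrite filter_pred0.
Qed.

Lemma APSD_run0 c W (G : wgraph 0) input mem0 :
  instance c (c + 20) W G input mem0 ->
  exists2 s, halts_with W (comp 0 (APSD c)) input mem0 s & outs s = [::].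
Proof.
case=> _ hk [_ h0 _] _.
have W1 : 1 < 2 ^ W by rewrite -[1]/(2 ^ 0) ltn_exp2l //; apply: leq_trans hk; rewrite muln_gt0 addn_gt0 orbT.
suff [s X hs] : lrun W input (APSD c) (init mem0) (fun s => outs s = [::]).
  exists (setpc (csize (APSD c)) s); first exact: comp_halts.
  by move: (csize _) => pc; case: s hs {X}.
sq; eapply l_const; [reflexivity | done | ].
sq; eapply l_input; [lk | exact: h0 | ].
by apply: run_if => //; apply: run_skip.
Qed.

(* [trunc_log 2 n] is the integer part of the binary logarithm of n. *)
Theorem theorem8 (c : nat) :
  exists (P : program) (k : nat),
    [/\ solves_APSD c k P,
        delay_in_O c k P
          (fun n (G : wgraph n) => (avg_deg G + (trunc_log 2 n)%:R)%R)
      & space_in_Theta c k P (fun n => n)].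
Proof.
exists (comp 0 (APSD c)), (c + 20); split.
- move=> W n G input mem0; case: n G => [|n] G inst; last first.
    by have [s [h1 h2 _ _ _]] := APSD_run (ltn0Sn n) inst; exists s.
  have [s hs E] := APSD_run0 inst; exists s => //; rewrite E.
  by split=> [|[]//]; rewrite (size0nil (size_enum_ord 0)).
- exists (90 * pace c) => W n G input mem0 s n1 inst hs.
  have [s' [h1 _ _ _ h2]] := APSD_run (ltnW n1) inst.
  rewrite (halts_with_uniq hs h1) /delay_le; apply: sub_path (h2 n1) => a b hab.
  rewrite Num.Theory.lerBlDl; apply: Order.POrderTheory.le_trans
    (_ : ((a + dbound c G)%:R <= _)%R); first by rewrite Num.Theory.ler_nat.
  by rewrite GRing.natrD Num.Theory.lerD2l dbound_le.
exists 1, (c + 10) => W n n1 hk; have n0 := ltnW n1; split.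
  move=> G input mem0 s inst hs; have [s' [h1 _ _ h2 _]] := APSD_run n0 inst.
  by rewrite (halts_with_uniq hs h1).
have hn : n < 2 ^ W.
  have /andP[_ h] := ndig_bounds n0; apply: leq_trans h _; rewrite leq_exp2l //.
  by apply: leq_trans hk; rewrite leq_pmull // addn_gt0 orbT.
have inst := empty_instance c hn hk.
have [s [h1 _ /ltnW h2 _ _]] := APSD_run n0 inst.
by exists (empty_graph n), (fun a => if a == 0 then n else 0), (fun=> 0), s; rewrite mul1n.
Qed.
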